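(* Let $a,b$ be nonnegative integers and let $F$ be a graph with chromatic number three that has a color-critical edge. Then $S_{a,b}$ is weakly $F$-Turán-good, i.e., for all sufficiently large $n$ there is an integer $m$ such that $\mathrm{ex}(n,S_{a,b},F)=\mathcal{N}(S_{a,b},K_{m,n-m})$.
   Context: The double star $S_{a,b}$ is the tree consisting of an edge $uv$ (the central edge), $a$ leaves adjacent to $u$ and $b$ leaves adjacent to $v$. An edge of a graph is color-critical if deleting it decreases the chromatic number. $\mathcal{N}(H,G)$ denotes the number of copies of $H$ in $G$, and $\mathrm{ex}(n,H,F)$ denotes the maximum of $\mathcal{N}(H,G)$ over all $n$-vertex graphs $G$ not containing $F$ as a subgraph. A graph $H$ is weakly $F$-Turán-good if for all sufficiently large $n$, $\mathrm{ex}(n,H,F)=\mathcal{N}(H,G)$ for some complete $(\chi(F)-1)$-partite $n$-vertex graph $G$. $K_{m,n-m}$ is the complete bipartite graph with parts of sizes $m$ and $n-m$. *)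

(* Defs.v *)
From HB Require Import structures.
From mathcomp Require Import all_boot.

Set Implicit Arguments.
Unset Strict Implicit.
Unset Printing Implicit Defensive.

Record sgraph (T : finType) := SGraph {
  edges : {set {set T}};
  edges_card2 : [forall e in edges, #|e| == 2]
}.

HB.instance Definition _ (T : finType) := [isSub for @edges T].
HB.instance Definition _ (T : finType) := [Finite of sgraph T by <:].

Definition adj (T : finType) (G : sgraph T) (x y : T) : bool :=
  [set x; y] \in edges G.

Definition rel_edges (T : finType) (r : rel T) : {set {set T}} :=
  [set [set p.1; p.2] | p : T * T & (p.1 != p.2) && r p.1 p.2].

Lemma rel_edges_card2 (T : finType) (r : rel T) :
  [forall e in rel_edges r, #|e| == 2].
Proof.
apply/forall_inP => e /imsetP[p]; rewrite inE => /andP[p12 _] ->.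
by rewrite cards2 p12.
Qed.

(* Edges are unordered, so [r] is implicitly symmetrised and loops are
   discarded. *)
Definition rel_graph (T : finType) (r : rel T) : sgraph T :=
  SGraph (rel_edges_card2 r).

Lemma del_edge_card2 (T : finType) (G : sgraph T) (e : {set T}) :
  [forall e' in edges G :\ e, #|e'| == 2].
Proof.
apply/forall_inP => e'; rewrite in_setD1 => /andP[_ Ge'].
by have /forall_inP/(_ e' Ge') := edges_card2 G.
Qed.

Definition del_edge (T : finType) (G : sgraph T) (e : {set T}) : sgraph T :=
  SGraph (del_edge_card2 G e).

Definition colorable (T : finType) (G : sgraph T) (k : nat) : bool :=
  [exists c : {ffun T -> 'I_k}, forall x, forall y, adj G x y ==> (c x != c y)].

Lemma exists_colorable (T : finType) (G : sgraph T) :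
  exists k, colorable G k.
Proof.
exists #|T|; apply/existsP; exists [ffun x => enum_rank x].
apply/forallP => x; apply/forallP => y; apply/implyP => Gxy; rewrite !ffunE.
apply: contraTneq Gxy => /enum_rank_inj ->; apply/negP => Gyy.
by have /forall_inP/(_ _ Gyy) := edges_card2 G; rewrite cards2 eqxx.
Qed.

Definition chromatic_number (T : finType) (G : sgraph T) : nat :=
  ex_minn (exists_colorable G).

Definition color_critical (T : finType) (G : sgraph T) (e : {set T}) : Prop :=
  e \in edges G /\ chromatic_number (del_edge G e) < chromatic_number G.

(* The subgraphs of [G], as pairs (vertex set, edge set), that are isomorphic
   to [H]. *)
Definition copies (U T : finType) (H : sgraph U) (G : sgraph T) :
    {set {set T} * {set {set T}}} :=
  [set S : {set T} * {set {set T}} |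
    (S.2 \subset edges G) &&
    [exists f : {ffun U -> T},
      [&& injectiveb f,
          S.1 == [set f x | x : U] &
          S.2 == [set f @: (e : {set U}) | e in edges H]]]].

Definition ncopies (U T : finType) (H : sgraph U) (G : sgraph T) : nat :=
  #|copies H G|.

Definition is_free (W T : finType) (F : sgraph W) (G : sgraph T) : bool :=
  copies F G == set0.

Definition turan_ex (n : nat) (U W : finType) (H : sgraph U) (F : sgraph W) : nat :=
  \max_(G : sgraph 'I_n | is_free F G) ncopies H G.

(* The parts are the fibres of [p]; they are required to be nonempty. *)
Definition complete_multipartite (k : nat) (T : finType) (G : sgraph T) : Prop :=
  exists p : T -> 'I_k,
    (forall i, exists x, p x = i) /\ (forall x y, adj G x y = (p x != p y)).

Definition weakly_turan_good (U W : finType) (H : sgraph U) (F : sgraph W)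
    : Prop :=
  exists n0 : nat, forall n : nat, n0 <= n ->
    exists G : sgraph 'I_n,
      complete_multipartite (chromatic_number F).-1 G /\
      turan_ex n H F = ncopies H G.

(* [inl None] and [inr None] are the ends u and v of the central edge;
   [inl (Some i)] and [inr (Some j)] are the leaves at u and at v. *)
Definition double_star_rel (a b : nat) : rel (option 'I_a + option 'I_b) :=
  fun x y =>
    match x, y with
    | inl None, inr None => true
    | inl None, inl (Some _) => true
    | inr None, inr (Some _) => true
    | _, _ => false
    end.

Definition double_star (a b : nat) : sgraph (option 'I_a + option 'I_b)%type :=
  rel_graph (@double_star_rel a b).

(* K_{m,n-m} on n vertices, when m <= n. *)
Definition complete_bipartite (n m : nat) : sgraph 'I_n :=
  rel_graph (fun x y : 'I_n => (x < m) && (m <= y)).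

(* Main.v *)
Require Import Defs.
From mathcomp Require Import all_boot all_order all_algebra.
From mathcomp Require Import zify ring lra.

(** Let [w x y = (x-1)_a (y-1)_b + (y-1)_a (x-1)_b] with falling factorials, so
    that [K_{x,y}] has [x * y * w x y] embeddings of the double star [S_{a,b}],
    while any graph has at most half the sum of [w (deg u) (deg v)] over ordered
    adjacent pairs.  Let [M] be the maximum of [x * y * w x y] over [x + y = n].

    An edge [uv] in no triangle has [deg u + deg v <= n], whence
    [w (deg u) (deg v) <= M / (deg u * (n - deg u))]; summing over edges, a
    triangle-free graph has at most [M/2 * \sum_u 1 / (n - deg u)] embeddings, and
    the Caro-Wei inequality bounds the last sum by 2.

    A graph without [F] has only [o(n^3)] triangles: a vertex whose neighbourhood
    is dense sees a large complete bipartite graph there (Kovari-Sos-Turan), and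
    the union contains a complete bipartite graph plus one edge in a part, hence
    [F].  The argument above is stable under few triangles: if there are at least
    [M] embeddings, the partition of the vertices into [N(u)] and its complement
    has [o(n^2)] inner edges for some [u].

    Now take a partition with fewest inner edges.  Since [F] is absent, all inner
    degrees are [o(n)], and the ends of an inner edge have few common neighbours
    across, so one of them misses linearly many cross edges.  As each missing
    cross edge costs on the order of [n^(a+b)] embeddings and each inner edge
    brings at most as many, up to a constant, inner edges do not pay off. *)

Set Implicit Arguments.
Unset Strict Implicit.
Unset Printing Implicit Defensive.

(** * Copies and embeddings *)

Lemma leq_expn2r e m n : m <= n -> m ^ e <= n ^ e.
Proof. by case: e => [|e] mn; rewrite ?expn0 // leq_exp2r. Qed.

Lemma adj_sym (T : finType) (G : sgraph T) : symmetric (adj G).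
Proof. by move=> x y; rewrite /adj setUC. Qed.

Lemma adj_irrefl (T : finType) (G : sgraph T) : irreflexive (adj G).
Proof.
move=> x; apply/negP => Gxx.
by have /forall_inP/(_ _ Gxx) := edges_card2 G; rewrite cards2 eqxx.
Qed.

Lemma edgesP (T : finType) (G : sgraph T) (e : {set T}) :
  reflect (exists x y, e = [set x; y] /\ adj G x y) (e \in edges G).
Proof.
apply: (iffP idP) => [Ge|]; last by case=> x [y [->]].
have /forall_inP/(_ _ Ge)/cards2P[x [y [xy eE]]] := edges_card2 G.
by exists x, y; rewrite /adj -eE.
Qed.

Lemma adj_rel_graph (T : finType) (r : rel T) x y :
  adj (rel_graph r) x y = (x != y) && (r x y || r y x).
Proof.
apply/imsetP/andP => [[[u v]] /[!inE] /= /andP[uv ruv] /setP exy|[xy rxy]].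
  have := exy x; have := exy y; have := exy u; have := exy v.
  rewrite !inE !eqxx ?orbT /= => /orP[]/eqP ev /orP[]/eqP eu.
  - by rewrite eu ev eqxx in uv.
  - by move=> _ _; rewrite -eu -ev eq_sym uv ruv orbT.
  - by move=> _ _; rewrite -eu -ev uv ruv.
  - by rewrite eu ev eqxx in uv.
case/orP: rxy => r_; first by exists (x, y); rewrite ?inE ?xy ?r_.
by exists (y, x); rewrite ?inE /= 1?eq_sym ?xy ?r_ // setUC.
Qed.

(** Injective homomorphisms. The source [r] may be a mere orientation of the edges, as
    [double_star_rel] is. *)
Definition embeddings (U T : finType) (r : rel U) (e : rel T) :
    {set {ffun U -> T}} :=
  [set f : {ffun U -> T} | injectiveb f &&
    [forall x, forall y, r x y ==> e (f x) (f y)]].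

Lemma embeddingsP (U T : finType) (r : rel U) (e : rel T) (f : {ffun U -> T}) :
  reflect (injective f /\ forall x y, r x y -> e (f x) (f y))
          (f \in embeddings r e).
Proof.
rewrite inE; apply: (iffP andP) => [[/injectiveP fi /forallP h]|[fi h]].
  by split=> // x y rxy; have /forallP/(_ y)/implyP := h x; apply.
by split; [exact/injectiveP | do 2 apply/forallP => ?; apply/implyP; exact: h].
Qed.

Definition image_copy (U T : finType) (H : sgraph U) (f : {ffun U -> T}) :
    {set T} * {set {set T}} :=
  ([set f x | x : U], [set f @: (e : {set U}) | e in edges H]).

Lemma image_copy_sub (U T : finType) (H : sgraph U) (G : sgraph T)
    (f : {ffun U -> T}) :
  ((image_copy H f).2 \subset edges G) =
  [forall x, forall y, adj H x y ==> adj G (f x) (f y)].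
Proof.
apply/subsetP/'forall_'forall_implyP => [h x y Hxy|h _ /imsetP[e He ->]].
  by rewrite /adj -imset_set1 -imset_set1 -imsetU; apply/h/imsetP; exists [set x; y].
by have /edgesP[x [y [-> Hxy]]] := He; rewrite imsetU !imset_set1 -/(adj _ _ _) h.
Qed.

Lemma copiesP (U T : finType) (H : sgraph U) (G : sgraph T) S :
  reflect (exists2 f : {ffun U -> T}, f \in embeddings (adj H) (adj G)
                                      & S = image_copy H f)
          (S \in copies H G).
Proof.
rewrite inE; apply: (iffP andP).
  case: S => S1 S2 /= [sub /existsP[f /and3P[fi /eqP e1 /eqP e2]]].
  exists f; last by rewrite /image_copy e1 e2.
  by rewrite inE fi -image_copy_sub /= -e2.
case=> f /[!inE] /andP[fi hf] ->; split; first by rewrite image_copy_sub.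
by apply/existsP; exists f; rewrite fi !eqxx.
Qed.

(** Embeddings with the same image differ by an automorphism of [H], and every embedding of the
    finite graph [H] in itself is an automorphism. *)
Lemma image_copy_fiber (U T : finType) (H : sgraph U) (G : sgraph T)
    (f0 : {ffun U -> T}) : f0 \in embeddings (adj H) (adj G) ->
  #|[set f in embeddings (adj H) (adj G) | image_copy H f == image_copy H f0]|
  = #|embeddings (adj H) (adj H)|.
Proof.
move=> /embeddingsP[f0i f0h].
pose post (s : {ffun U -> U}) := [ffun x => f0 (s x)].
have post_inj : injective post.
  by move=> s t /ffunP h; apply/ffunP => x; have := h x; rewrite !ffunE => /f0i.
rewrite -(card_imset _ post_inj); apply/eq_card => f; rewrite inE.
have im2 (s : {ffun U -> U}) (A : {set U}) : post s @: A = f0 @: (s @: A).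
  by rewrite -imset_comp; apply: eq_imset => x; rewrite ffunE.
apply/andP/imsetP => [[/embeddingsP[fi fh] /eqP[e1 e2]]|[s /embeddingsP[si sh] ->]].
  have /fin_all_exists[s fE] x : exists y, f x = f0 y.
    have : f x \in [set f0 x | x : U] by rewrite -e1 imset_f.
    by case/imsetP => y _ ->; exists y.
  exists [ffun x => s x]; last by apply/ffunP => x; rewrite !ffunE fE.
  apply/embeddingsP; split=> [x y|x y Hxy].
    by rewrite !ffunE => exy; apply: fi; rewrite !fE exy.
  have : f @: [set x; y] \in [set f0 @: (e : {set U}) | e in edges H].
    by rewrite -e2; apply: imset_f.
  case/imsetP => e He; rewrite imsetU !imset_set1 !fE !ffunE /adj => eqe.
  suff -> : [set s x; s y] = e by [].
  by apply: (imset_inj f0i); rewrite -eqe imsetU !imset_set1.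
split.
  apply/embeddingsP; split=> [x y|x y /sh/f0h]; rewrite !ffunE //.
  by move=> /f0i/si.
have imT (V : finType) (g : U -> V) : [set g x | x : U] = g @: [set: U].
  by apply/setP => y; apply/imsetP/imsetP => -[x _ ->]; exists x.
have sT : s @: [set: U] = setT.
  by apply/eqP; rewrite eqEcard subsetT /= card_imset // cardsT.
have sE : [set s @: (e : {set U}) | e in edges H] = edges H.
  apply/eqP; rewrite eqEcard card_imset ?leqnn ?andbT; last exact: imset_inj.
  apply/subsetP => _ /imsetP[e /edgesP[x [y [-> Hxy]]] ->].
  by rewrite imsetU !imset_set1; apply: sh.
apply/eqP; congr (_, _).
  by rewrite (imT _ (post s)) (imT _ f0) im2 sT.
rewrite -[in RHS]sE -imset_comp; apply: eq_imset => e /=; exact: im2.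
Qed.

Lemma card_embeddings (U T : finType) (H : sgraph U) (G : sgraph T) :
  #|embeddings (adj H) (adj G)| =
  ncopies H G * #|embeddings (adj H) (adj H)|.
Proof.
rewrite -sum1_card (partition_big (image_copy H) (mem (copies H G))) /=; last first.
  by move=> f fe; apply/copiesP; exists f.
rewrite /ncopies -sum_nat_const; apply: eq_bigr => S /copiesP[f0 f0e ->].
rewrite -(image_copy_fiber f0e) -sum1_card.
by apply: eq_bigl => f; rewrite [RHS]inE.
Qed.

(** The number of automorphisms is positive, so it cancels; comparing copies thus becomes comparing
    embeddings. *)
Lemma ncopies_le (U T T' : finType) (H : sgraph U) (G : sgraph T) (G' : sgraph T') :
  (ncopies H G <= ncopies H G') =
  (#|embeddings (adj H) (adj G)| <= #|embeddings (adj H) (adj G')|).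
Proof.
rewrite (card_embeddings H G) (card_embeddings H G') leq_pmul2r //; apply/card_gt0P.
exists [ffun x => x]; apply/embeddingsP; split=> [x y|x y]; rewrite !ffunE //.
Qed.

Lemma is_freeP (W T : finType) (F : sgraph W) (G : sgraph T) :
  reflect (embeddings (adj F) (adj G) = set0) (is_free F G).
Proof.
apply: (iffP eqP) => [h|h].
  apply/eqP; apply: contra_eqT h => /set0Pn[f fe]; apply/set0Pn.
  by exists (image_copy F f); apply/copiesP; exists f.
apply/eqP; apply: contra_eqT h => /set0Pn[S /copiesP[f fe _]].
by apply/set0Pn; exists f.
Qed.

(** * Embeddings of double stars *)

Lemma embeddings_rel_graph (U T : finType) (r : rel U) (e : rel T) :
  irreflexive r -> symmetric e ->
  embeddings (adj (rel_graph r)) e = embeddings r e.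
Proof.
move=> rI eS; apply/setP => f.
apply/embeddingsP/embeddingsP => -[fi h]; split=> // x y.
  move=> rxy; apply: h; rewrite adj_rel_graph rxy andbT.
  by apply: contraTneq rxy => ->; rewrite rI.
by rewrite adj_rel_graph => /andP[_ /orP[/h|/h]] //; rewrite eS.
Qed.

Definition nbhd (T : finType) (e : rel T) (x : T) : {set T} := [set y | e x y].

Notation deg e x := #|nbhd e x|.

Section DoubleStarEmbeddings.
Variables (T : finType) (e : rel T) (a b : nat).
Hypotheses (eS : symmetric e) (eI : irreflexive e).
Implicit Types u v x y : T.

Let emb := embeddings (@double_star_rel a b) e.

Definition centred u v : {set {ffun option 'I_a + option 'I_b -> T}} :=
  [set f in embeddings (@double_star_rel a b) e |
    (f (inl None) == u) && (f (inr None) == v)].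

Let inj_into (c : nat) (A : {set T}) : {set {ffun 'I_c -> T}} :=
  [set g in ffun_on (mem A) | injectiveb g].

Let card_inj_into c A : #|inj_into c A| = #|A| ^_ c.
Proof. by rewrite /inj_into card_inj_ffuns_on card_ord. Qed.

Lemma card_embeddings_centred : #|emb| = \sum_u \sum_v #|centred u v|.
Proof.
rewrite pair_big -sum1_card /=.
rewrite (partition_big (fun f : {ffun _ -> T} => (f (inl None), f (inr None))) predT) //=.
apply: eq_bigr => -[u v] _; rewrite -sum1_card; apply: eq_bigl => f.
by rewrite [in RHS]inE xpair_eqE.
Qed.

Lemma centred0 u v : ~~ e u v -> #|centred u v| = 0.
Proof.
move=> nuv; apply: eq_card0 => f; rewrite inE; apply/negP.
case/and3P => /embeddingsP[_ h] /eqP fu /eqP fv.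
by have := h (inl None) (inr None) isT; rewrite fu fv (negPf nuv).
Qed.

Lemma card_nbhd_rem u v : e u v -> #|nbhd e u :\ v| = (deg e u).-1.
Proof. by move=> uv; rewrite (cardsD1 v (nbhd e u)) inE uv. Qed.

(** With the centres fixed, an embedding is a pair of injective tuples of leaves. Equality may fail
    because the two tuples can meet in a common neighbour. *)
Lemma card_centred_le u v : e u v ->
  #|centred u v| <= (deg e u).-1 ^_ a * (deg e v).-1 ^_ b.
Proof.
move=> uv; rewrite -(card_nbhd_rem uv) -(@card_nbhd_rem v u) 1?eS //.
rewrite -!card_inj_into -cardsX.
pose leaves (f : {ffun option 'I_a + option 'I_b -> T}) :=
  ([ffun i => f (inl (Some i))], [ffun j => f (inr (Some j))])
  : {ffun 'I_a -> T} * {ffun 'I_b -> T}.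
have li : {in centred u v &, injective leaves}.
  move=> f g /[!inE] /and3P[_ /eqP fu /eqP fv] /and3P[_ /eqP gu /eqP gv].
  case=> /ffunP e1 /ffunP e2; apply/ffunP => -[[i|]|[j|]].
  - by have := e1 i; rewrite !ffunE.
  - by rewrite fu gu.
  - by have := e2 j; rewrite !ffunE.
  - by rewrite fv gv.
rewrite -(card_in_imset li); apply/subset_leq_card/subsetP.
move=> _ /imsetP[f /setIdP[/embeddingsP[fi h] /andP[/eqP fu /eqP fv]] ->].
rewrite !inE /=.
apply/andP; split; apply/andP; split.
- apply/ffun_onP => i; rewrite ffunE !inE -fv -fu h // andbT.
  by apply/eqP => /fi.
- by apply/injectiveP => i j; rewrite !ffunE => /fi[].
- apply/ffun_onP => i; rewrite ffunE !inE -fv -fu h // andbT.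
  by apply/eqP => /fi.
- by apply/injectiveP => i j; rewrite !ffunE => /fi[].
Qed.

(** Disjoint neighbourhoods keep the two tuples of leaves apart, so any two of them glue to an
    embedding. *)
Lemma card_centred_ge u v : e u v -> [disjoint nbhd e u & nbhd e v] ->
  (deg e u).-1 ^_ a * (deg e v).-1 ^_ b <= #|centred u v|.
Proof.
move=> uv dis; rewrite -(card_nbhd_rem uv) -(@card_nbhd_rem v u) 1?eS //.
rewrite -!card_inj_into -cardsX.
pose glue (gh : {ffun 'I_a -> T} * {ffun 'I_b -> T}) :
    {ffun option 'I_a + option 'I_b -> T} :=
  [ffun z => match z with
    | inl None => u | inl (Some i) => gh.1 i
    | inr None => v | inr (Some j) => gh.2 j end].
have gi : injective glue.
  move=> [g h] [g' h'] /ffunP eq; congr (_, _); apply/ffunP => i.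
    by have := eq (inl (Some i)); rewrite !ffunE.
  by have := eq (inr (Some i)); rewrite !ffunE.
rewrite -(card_imset _ gi); apply/subset_leq_card/subsetP.
move=> f /imsetP[[g h] /setXP[/setIdP[/ffun_onP gN /injectiveP g_i]]].
move=> /setIdP[/ffun_onP hN /injectiveP h_i] ->{f}.
have gP i : [/\ g i != v, g i != u & e u (g i)].
  have := gN i; rewrite !inE => /andP[-> egi]; split=> //.
  by apply: contraTneq egi => ->; rewrite eI.
have hP i : [/\ h i != v, h i != u & e v (h i)].
  have := hN i; rewrite !inE => /andP[-> ehi]; split=> //.
  by apply: contraTneq ehi => ->; rewrite eI.
have gh i j : g i != h j.
  have [_ _ egi] := gP i; have [_ _ ehj] := hP j.
  apply: contraTneq dis => gh; apply/pred0Pn; exists (g i).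
  by rewrite /= !inE egi gh.
have uv_neq : u != v by apply: contraTneq uv => ->; rewrite eI.
rewrite inE !ffunE !eqxx !andbT; apply/embeddingsP; split.
  move=> [[i|]|[i|]] [[j|]|[j|]]; rewrite !ffunE //=.
  - by move/g_i ->.
  - by have [_ /eqP] := gP i.
  - by move/eqP; rewrite (negPf (gh _ _)).
  - by have [/eqP] := gP i.
  - by have [_ /eqP] := gP j => ? _ /esym.
  - by have [_ /eqP] := hP j => ? _ /esym.
  - by move/eqP; rewrite (negPf uv_neq).
  - by move/esym/eqP; rewrite (negPf (gh _ _)).
  - by have [_ /eqP] := hP i.
  - by move/h_i ->.
  - by have [/eqP] := hP i.
  - by have [/eqP ? _ _] := gP j => /esym.
  - by move/esym/eqP; rewrite (negPf uv_neq).
  - by have [/eqP ? _ _] := hP j => /esym.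
move=> [[i|]|[i|]] [[j|]|[j|]] //= _; rewrite !ffunE //.
  by have [] := gP j.
by have [] := hP j.
Qed.

Lemma card_embeddings_le :
  #|emb| <= \sum_u \sum_(v | e u v) (deg e u).-1 ^_ a * (deg e v).-1 ^_ b.
Proof.
rewrite card_embeddings_centred; apply: leq_sum => u _; rewrite [leqRHS]big_mkcond /=.
by apply: leq_sum => v _; case: ifPn => [/card_centred_le|/centred0 ->].
Qed.

End DoubleStarEmbeddings.

(** Both orientations of the central edge are counted. The predecessors leave out the other centre,
    which cannot be a leaf. *)
Definition weight (a b x y : nat) : nat :=
  x.-1 ^_ a * y.-1 ^_ b + y.-1 ^_ a * x.-1 ^_ b.

Definition two_parts (T : finType) (p : pred T) : rel T := fun x y => p x != p y.

Section CompleteBipartite.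
Variables (T : finType) (p : pred T) (a b : nat).

Lemma two_parts_sym : symmetric (two_parts p).
Proof. by move=> x y; rewrite /two_parts eq_sym. Qed.

Lemma two_parts_irrefl : irreflexive (two_parts p).
Proof. by move=> x; rewrite /two_parts eqxx. Qed.

Lemma nbhd_two_parts x :
  nbhd (two_parts p) x = if p x then [set y | ~~ p y] else [set y | p y].
Proof.
by apply/setP => y; rewrite inE /two_parts; case: ifP => px; rewrite inE; case: (p y).
Qed.

Lemma card_centred_two_parts u v : p u != p v ->
  #|centred (two_parts p) a b u v| =
  (deg (two_parts p) u).-1 ^_ a * (deg (two_parts p) v).-1 ^_ b.
Proof.
move=> uv; apply/eqP; rewrite eqn_leq card_centred_le //; last exact: two_parts_sym.
apply: card_centred_ge => //; [exact: two_parts_sym|exact: two_parts_irrefl|].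
rewrite disjoint_subset; apply/subsetP => y; rewrite !inE /two_parts.
by move: uv; case: (p u); case: (p v); case: (p y).
Qed.

Lemma card_embeddings_two_parts :
  #|embeddings (@double_star_rel a b) (two_parts p)| =
  #|[set x | p x]| * #|[set x | ~~ p x]| *
  weight a b #|[set x | p x]| #|[set x | ~~ p x]|.
Proof.
set x := #|[set x | p x]|; set y := #|[set x | ~~ p x]|.
rewrite card_embeddings_centred.
have inner u : \sum_v #|centred (two_parts p) a b u v| =
    if p u then y * (y.-1 ^_ a * x.-1 ^_ b)
           else x * (x.-1 ^_ a * y.-1 ^_ b).
  have -> : \sum_v #|centred (two_parts p) a b u v| =
     \sum_(v in nbhd (two_parts p) u)
        (deg (two_parts p) u).-1 ^_ a * (deg (two_parts p) v).-1 ^_ b.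
    rewrite [RHS]big_mkcond; apply: eq_bigr => v _; rewrite inE.
    by case: ifPn => [/card_centred_two_parts //|/centred0].
  rewrite !nbhd_two_parts; case: ifPn => pu.
    rewrite -sum_nat_const; apply: eq_bigr => v.
    by rewrite inE nbhd_two_parts => /negPf ->.
  rewrite -sum_nat_const; apply: eq_bigr => v.
  by rewrite inE nbhd_two_parts => ->.
rewrite (bigID p) /=.
rewrite (eq_bigr (fun=> y * (y.-1 ^_ a * x.-1 ^_ b))); last first.
  by move=> u pu; rewrite inner pu.
rewrite [X in _ + X](eq_bigr (fun=> x * (x.-1 ^_ a * y.-1 ^_ b))); last first.
  by move=> u pu; rewrite inner (negPf pu).
rewrite !sum_nat_cond_const -/x -/y /weight; nia.
Qed.
End CompleteBipartite.

(** * Dense pairs and graphs without F *)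

Lemma exchange_card (T : finType) (e : rel T) (A B : {set T}) :
  \sum_(x in A) #|[set y in B | e x y]| = \sum_(y in B) #|[set x in A | e x y]|.
Proof.
transitivity (\sum_(x in A) \sum_(y in B | e x y) 1).
  by apply: eq_bigr => x _; rewrite sum1dep_card.
rewrite (exchange_big_dep (mem B)) /=; last by move=> x y _ /andP[].
apply: eq_bigr => y yB; rewrite sum1dep_card; apply: eq_card => x.
by rewrite !inE yB.
Qed.

(** Kovari-Sos-Turan, one vertex of [Q'] at a time: by averaging, some [q] in [Q] is joined to at
    least a fraction [d / #|T|] of [L]. The surplus [s] in the degrees pays for the vertices already
    taken from [Q]. *)
Lemma complete_pair_greedy (T : finType) (e : rel T) (d s : nat) (L Q : {set T}) :
  0 < d -> 0 < #|L| -> (forall x, x \in L -> d + s <= #|[set y in Q | e x y]|) ->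
  exists L' Q' : {set T}, [/\ L' \subset L, Q' \subset Q, #|Q'| = s,
    d ^ s * #|L| <= #|T| ^ s * #|L'| & {in L' & Q', forall x y, e x y}].
Proof.
move=> d0; elim: s L Q => [|s IHs] L Q L0 degL.
  exists L, set0; split=> //; rewrite ?sub0set ?cards0 ?expn0 //.
  by move=> x y _; rewrite inE.
have [q qQ qL] : exists2 q, q \in Q & d * #|L| <= #|T| * #|[set x in L | e x q]|.
  apply/exists_inP; apply: contraLR L0 => /exists_inPn h.
  have {}h q : q \in Q -> #|T| * #|[set x in L | e x q]| < d * #|L|.
    by move=> /h; rewrite -ltnNge.
  rewrite lt0n negbK; apply/negPn/negP => L0.
  have [x xL] : exists x, x \in L by apply/set0Pn; rewrite -cards_eq0.
  have [q qQ] : exists q, q \in Q.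
    apply/set0Pn; apply: contraTneq (degL x xL) => ->; rewrite -ltnNge.
    by rewrite eq_card0 ?addnS // => y; rewrite !inE.
  have lb : #|L| * d <= \sum_(x in L) #|[set y in Q | e x y]|.
    by rewrite -sum_nat_const; apply: leq_sum => z /degL; lia.
  have ub : \sum_(y in Q) #|T| * #|[set x in L | e x y]| <= #|Q| * (d * #|L|).-1.
    by rewrite -sum_nat_const; apply: leq_sum => z /h; lia.
  have Q0 : 0 < #|Q| by apply/card_gt0P; exists q.
  have QT := max_card (mem Q); move: ub; rewrite -big_distrr -exchange_card /=.
  move: lb; set S := \sum_(x in L) _ => lb ub.
  have : #|T| * (#|L| * d) <= #|Q| * (d * #|L|).-1.
    by apply: leq_trans ub; rewrite leq_mul2l lb orbT.
  apply/negP; rewrite -ltnNge [#|L| * d]mulnC.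
  apply: (@leq_trans (#|Q| * (d * #|L|))); last by rewrite leq_mul2r QT orbT.
  by rewrite ltn_pmul2l // prednK ?muln_gt0 ?d0 //; rewrite lt0n in L0 *.
have L1 : 0 < #|[set x in L | e x q]| by nia.
have [|L' [Q' [sL sQ cQ cL h]]] := IHs _ (Q :\ q) L1.
  move=> x; rewrite inE => /andP[xL exq].
  have := degL x xL; rewrite (cardsD1 q) !inE qQ exq addnS add1n ltnS.
  by congr (_ <= _); apply: eq_card => y; rewrite !inE andbA.
exists L', (q |: Q'); split.
- by apply: subset_trans sL _; apply/subsetP => x; rewrite inE => /andP[].
- by rewrite subUset sub1set qQ (subset_trans sQ) ?subD1set.
- rewrite cardsU1 cQ; case: (boolP (q \in Q')) => // /(subsetP sQ).
  by rewrite !inE eqxx.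
- rewrite !expnS.
  apply: (@leq_trans (#|T| * (d ^ s * #|[set x in L | e x q]|))); first nia.
  by rewrite -mulnA leq_mul2l cL orbT.
- move=> x y xL' /setU1P[->|yQ']; last exact: h.
  by have := subsetP sL _ xL'; rewrite inE => /andP[].
Qed.

Lemma complete_pair_dense (k s : nat) : 0 < k ->
  exists n0, forall (T : finType) (e : rel T) (L Q : {set T}),
    n0 <= #|T| ->
    #|T| ^ 2 < k * \sum_(x in L) #|[set y in Q | e x y]| ->
    exists L' Q' : {set T}, [/\ L' \subset L, Q' \subset Q, s <= #|L'|,
      s <= #|Q'| & {in L' & Q', forall x y, e x y}].
Proof.
(* The first summand yields [s <= #|L'|]; the second gives [n <= 8 * k * d] and room for the surplus
   [s]. *)
move=> k0; exists (2 * k * (8 * k) ^ s * s + 8 * k * s.+1) => T e L Q nn dense.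
set n := #|T| in nn dense *.
pose dg x := #|[set y in Q | e x y]|.
(* Vertices of degree below [n / (2k)] contribute at most half of the required total, so more than
   [n / (2k)] vertices remain. *)
pose L0 := [set x in L | n <= 2 * k * dg x].
have L0big : n < 2 * k * #|L0|.
  have ub : 2 * k * (\sum_(x in L) dg x) <= 2 * k * (#|L0| * n) + n * n.
    rewrite (bigID (mem L0)) /= mulnDr leq_add //.
      rewrite leq_mul2l; apply/orP; right.
      apply: (@leq_trans (\sum_(x in L0) n)); last by rewrite sum_nat_const.
      rewrite [leqRHS]big_mkcond [leqLHS]big_mkcond; apply: leq_sum => x _.
      rewrite inE; case: (x \in L) => //=; case: ifP => // _.
      exact: max_card.
    rewrite big_distrr /=.
    apply: (@leq_trans (\sum_(x in L | x \notin L0) n)).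
      by apply: leq_sum => x /andP[xL]; rewrite inE xL -ltnNge => /ltnW.
    rewrite sum_nat_cond_const leq_mul2r; apply/orP; right; exact: max_card.
  by move: dense ub; rewrite -/dg; set S := \sum_(x in L) _; nia.
pose d := n %/ (4 * k).
have k40 : 0 < 4 * k by lia.
have dn : 4 * k * d <= n by rewrite mulnC leq_divM.
have nd : n < 4 * k * d.+1 by rewrite mulnC -ltn_divLR.
have nd8 : n <= 8 * k * d by move: nn; rewrite mulnS; lia.
have d0 : 0 < d by move: nn nd8; case: (d) => //; rewrite mulnS; lia.
have L00 : 0 < #|L0| by move: L0big; case: #|L0| => //; lia.
have [|L' [Q' [sL sQ cQ cL h]]] := @complete_pair_greedy T e d s L0 Q d0 L00.
  move=> x; rewrite inE => /andP[xL]; rewrite -/(dg x) => dgx.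
  have : 2 * k * (d + s) <= 2 * k * dg x by move: nn; rewrite mulnS; lia.
  by rewrite leq_pmul2l //; lia.
exists L', Q'; split; rewrite ?cQ //.
  by apply: subset_trans sL _; apply/subsetP => x; rewrite inE => /andP[].
have n0 : 0 < n by move: nn; rewrite mulnS; lia.
have le1 : #|L0| <= (8 * k) ^ s * #|L'|.
  rewrite -(@leq_pmul2l (n ^ s)) ?expn_gt0 ?n0 //.
  apply: (@leq_trans ((8 * k) ^ s * (d ^ s * #|L0|))).
    by rewrite mulnA leq_mul2r -expnMn leq_expn2r ?nd8 ?orbT.
  by rewrite [leqRHS]mulnCA leq_mul2l cL orbT.
have le2 : 2 * k * (8 * k) ^ s * s < 2 * k * (8 * k) ^ s * #|L'|.
  apply: (@leq_ltn_trans n); first by lia.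
  by apply: (leq_trans L0big); rewrite -[leqRHS]mulnA leq_mul2l le1 orbT.
by move: le2; rewrite ltn_mul2l => /andP[_ /ltnW].
Qed.

Lemma exists_injection_into (V T : finType) (A : {set T}) : #|V| <= #|A| ->
  exists2 g : V -> T, injective g & forall z, g z \in A.
Proof.
move=> VA; exists (fun z => enum_val (widen_ord VA (enum_rank z))).
  by move=> x y /enum_val_inj/(congr1 val)/= /val_inj/enum_rank_inj.
by move=> z; apply: enum_valP.
Qed.

(** * Three-chromatic graphs with a critical edge *)

Lemma colorable_leq (T : finType) (G : sgraph T) k m :
  k <= m -> colorable G k -> colorable G m.
Proof.
move=> km /existsP[c /'forall_'forall_implyP h]; apply/existsP.
exists [ffun x => widen_ord km (c x)]; apply/'forall_'forall_implyP => x y /h.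
by rewrite !ffunE; apply: contra => /eqP/(congr1 val)/= /val_inj ->.
Qed.

(** Take a 2-colouring of [F] minus the critical edge [pq]. The ends [p] and [q] agree in it, since
    otherwise [F] itself would be 2-colourable. *)
Lemma color_critical_2coloring (V : finType) (F : sgraph V) (e : {set V}) :
  chromatic_number F = 3 -> color_critical F e ->
  exists (p q : V) (c : V -> bool), [/\ p != q, c p = c q &
    forall x y, adj F x y -> [set x; y] != [set p; q] -> c x != c y].
Proof.
move=> chi [Fe]; rewrite chi {1}/chromatic_number; case: ex_minnP => k col _ k3.
have [p [q [eE Fpq]]] := edgesP _ _ Fe.
have /existsP[c /'forall_'forall_implyP h] := colorable_leq (ltnSE k3) col.
pose cb x := c x == ord0.
have cb_neq x y : (c x != c y) = (cb x != cb y).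
  rewrite /cb; case: (c x) (c y) => [[|[|?]] ?] [[|[|?]] ?] //.
have hF x y : adj F x y -> [set x; y] != [set p; q] -> cb x != cb y.
  move=> Fxy xy; rewrite -cb_neq; apply: h.
  by rewrite /adj /= in_setD1 eE xy.
exists p, q, cb; split=> //.
  by apply: contraTneq Fpq => ->; rewrite adj_irrefl.
case: (eqVneq (cb p) (cb q)) => // cpq; exfalso.
suff : colorable F 2.
  by move: chi; rewrite /chromatic_number; case: ex_minnP => m _ hm mE /hm; rewrite mE.
apply/existsP; exists c; apply/'forall_'forall_implyP => x y Fxy; rewrite cb_neq.
have [exy|] := eqVneq [set x; y] [set p; q]; last exact: hF.
have : p \in [set x; y] by rewrite exy set21.
have : q \in [set x; y] by rewrite exy set22.
have : x \in [set p; q] by rewrite -exy set21.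
have : y \in [set p; q] by rewrite -exy set22.
rewrite !inE => /orP[]/eqP -> /orP[]/eqP ->; rewrite ?eqxx ?orbb //.
- by move=> /eqP qp; rewrite qp eqxx in cpq.
- by move=> _ _; rewrite eq_sym.
- by move=> _ /eqP qp; rewrite qp eqxx in cpq.
Qed.

Section CriticalFree.
Variables (V : finType) (F : sgraph V).
Hypothesis chiF : chromatic_number F = 3.
Hypothesis critF : exists e : {set V}, color_critical F e.

(** The set [L] with [x] and [y] is completely joined to [Q], and [xy] is an extra edge inside one
    side; [F] embeds there. *)
Lemma edge_plus_complete_pair (T : finType) (G : sgraph T) x y (L Q : {set T}) :
  is_free F G -> adj G x y -> x \notin L -> y \notin L ->
  #|V| <= #|L| -> #|V| <= #|Q| ->
  {in L & Q, forall l q, adj G l q} ->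
  (forall q, q \in Q -> adj G x q && adj G y q) -> False.
Proof.
move=> /is_freeP free Gxy xL yL cL cQ LQ xyQ.
have [e ce] := critF.
have [p [q [c [pq cpq hc]]]] := color_critical_2coloring chiF ce.
have [gL gLi gLP] := exists_injection_into cL.
have [gQ gQi gQP] := exists_injection_into cQ.
(* The colour class of the critical edge goes to [L] with [x] and [y], the critical edge itself to
   [xy], and the other class to [Q]. *)
pose side z := if z == p then x else if z == q then y else gL z.
pose f : {ffun V -> T} := [ffun z => if c z == c p then side z else gQ z].
have xy : x != y by apply: contraTneq Gxy => ->; rewrite adj_irrefl.
have sideQ z z' : adj G (side z) (gQ z').
  rewrite /side; have /andP[? ?] := xyQ _ (gQP z').
  by case: eqP => // _; case: eqP => // _; apply: LQ.
have sidei : injective side.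
  move=> z z'; rewrite /side.
  case: eqP => [->|_]; case: eqP => [->|_] //; case: eqP => [->|_] //;
    try case: eqP => [->|_] //; try exact: gLi; move=> E; exfalso;
    move: xy xL yL; rewrite ?E ?eqxx ?gLP // -?E ?gLP //.
suff : f \in embeddings (adj F) (adj G) by rewrite free inE.
apply/embeddingsP; split=> [z z'|z z' Fz]; rewrite !ffunE.
  case: eqP => cz; case: eqP => cz'; [exact: sidei| | |exact: gQi] => E; exfalso.
    by have := sideQ z z'; rewrite E adj_irrefl.
  by have := sideQ z' z; rewrite E adj_irrefl.
have [exy|ne] := eqVneq [set z; z'] [set p; q]; last first.
  have := hc _ _ Fz ne; case: ifP => cz; case: ifP => cz'; rewrite ?sideQ //.
  - by rewrite (eqP cz) (eqP cz') eqxx.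
  - by rewrite adj_sym.
  - by move: cz cz'; case: (c z); case: (c z'); case: (c p).
have : z \in [set p; q] by rewrite -exy set21.
have : z' \in [set p; q] by rewrite -exy set22.
have qp : (q == p) = false by rewrite eq_sym (negPf pq).
rewrite !inE => /orP[]/eqP z'E /orP[]/eqP zE; move: Fz;
  rewrite z'E zE ?adj_irrefl // /side -?cpq !eqxx ?qp ?eqxx // => _.
by rewrite adj_sym.
Qed.

(** A dense neighbourhood of [x] contains a large complete pair [L], [Q]. For any [y] in [L], both
    ends of [xy] are joined to all of [Q]; the successor in the size allows for removing [y] from
    [L]. *)
Lemma free_sparse_nbhd k : 0 < k -> exists n0, forall (T : finType) (G : sgraph T) x,
  n0 <= #|T| -> is_free F G ->
  k * \sum_(y in nbhd (adj G) x) #|[set z in nbhd (adj G) x | adj G y z]| <= #|T| ^ 2.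
Proof.
move=> /(@complete_pair_dense _ #|V|.+1)[n0 h]; exists n0 => T G x nn free.
rewrite leqNgt; apply/negP => /(h _ _ _ _ nn)[L [Q [sL sQ cL cQ LQ]]].
have [y yL] : exists y, y \in L by apply/card_gt0P; lia.
have LN l : l \in L -> adj G x l by move/(subsetP sL); rewrite inE.
have QN q : q \in Q -> adj G x q by move/(subsetP sQ); rewrite inE.
apply: (@edge_plus_complete_pair T G x y (L :\ y) Q) => //.
- exact: LN.
- by rewrite !inE negb_and; apply/orP; right; apply/negP => /LN; rewrite adj_irrefl.
- by rewrite !inE eqxx.
- by move: cL; rewrite (cardsD1 y) yL add1n ltnS.
- exact: ltnW.
- by move=> l q /setD1P[_ lL]; apply: LQ.
- by move=> q qQ; rewrite QN ?LQ.
Qed.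

(** The same obstruction with [Q] among the common neighbours of [x] and [y]. Here [L] may contain
    [x] and [y], and its size leaves room to discard both. *)
Lemma free_sparse_codegree k : 0 < k ->
  exists n0, forall (T : finType) (G : sgraph T) x y,
  n0 <= #|T| -> is_free F G -> adj G x y ->
  k * \sum_l #|[set q in nbhd (adj G) x :&: nbhd (adj G) y | adj G l q]| <= #|T| ^ 2.
Proof.
move=> /(@complete_pair_dense _ #|V|.+2)[n0 h]; exists n0 => T G x y nn free Gxy.
rewrite leqNgt; apply/negP => lt.
have [|L [Q [_ sQ cL cQ LQ]]] :=
    h T (adj G) setT (nbhd (adj G) x :&: nbhd (adj G) y) nn.
  by apply: (leq_trans lt); rewrite leq_mul2l; apply/orP; right; under [leqRHS]eq_bigl do rewrite inE.
apply: (@edge_plus_complete_pair T G x y (L :\: [set x; y]) Q) => //.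
- by rewrite !inE eqxx.
- by rewrite !inE eqxx orbT.
- rewrite cardsD; have := subset_leq_card (subsetIr L [set x; y]).
  by move: cL; rewrite cards2; lia.
- by lia.
- by move=> l q /setDP[lL _]; apply: LQ.
- by move=> q /(subsetP sQ); rewrite !inE.
Qed.

End CriticalFree.

(** * Stability *)

Section WeightedPartition.
Import Order.TTheory GRing.Theory Num.Theory.
Local Open Scope ring_scope.

Variables (R : realFieldType) (T : finType) (e : rel T) (X : T -> R).
Hypothesis eS : symmetric e.
Hypothesis X_ge0 : forall u, 0 <= X u.
Hypothesis X_deg : forall u, (#|T|%:R - (deg e u)%:R) * X u <= 1.

(** By weight, [D u] is the degree, [P] and [Tw] count ordered adjacent pairs and triangles, and
    [inner u] counts the adjacent pairs not separated by the cut into [N(u)] and its complement. *)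
Let adjR u v : R := (e u v)%:R.
Let S := \sum_u X u.
Let D u := \sum_v X v * adjR u v.
Let P := \sum_u X u * D u.
Let Tw := \sum_u \sum_v \sum_w X u * X v * X w * (adjR u v * adjR u w * adjR v w).
Let inner u := \sum_v \sum_w X v * X w * (e v w && (e u v == e u w))%:R.

Let adjRC u v : adjR u v = adjR v u.
Proof. by rewrite /adjR eS. Qed.

Let sum_adjR u : \sum_v adjR u v = (deg e u)%:R.
Proof.
rewrite -sum1_card natr_sum [RHS]big_mkcond /=; apply: eq_bigr => v _.
by rewrite inE /adjR; case: (e u v).
Qed.

Let adjR_ge0 u v : 0 <= adjR u v. Proof. exact: ler0n. Qed.
Let adjR_le1 u v : adjR u v <= 1. Proof. by rewrite /adjR; case: (e u v); rewrite ?ler01. Qed.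

Let S_ge0 : 0 <= S. Proof. exact: sumr_ge0. Qed.

Let S2 : S ^+ 2 = \sum_u \sum_v X u * X v.
Proof. by rewrite expr2 mulr_suml; apply: eq_bigr => u _; rewrite mulr_sumr. Qed.

Let PE : P = \sum_u \sum_v X u * X v * adjR u v.
Proof. by apply: eq_bigr => u _; rewrite mulr_sumr; apply: eq_bigr => v _; rewrite mulrA. Qed.

Let P_ge0 : 0 <= P.
Proof. by rewrite PE; do 2 apply: sumr_ge0 => ? _; rewrite !mulr_ge0. Qed.

Let P_le : P <= S ^+ 2.
Proof.
rewrite PE S2; apply: ler_sum => u _; apply: ler_sum => v _.
by apply: ler_piMr; rewrite ?mulr_ge0.
Qed.

(* On a non-adjacent pair [X u * X v <= (X u ^+ 2 + X v ^+ 2) / 2], and [u] lies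
   in [#|T| - deg e u] such pairs: this is the Caro-Wei bound in disguise. *)
Let P_ge : S ^+ 2 - S <= P.
Proof.
suff : S ^+ 2 - P <= S by lra.
have nonadj (f : T -> R) : \sum_u \sum_v (1 - adjR u v) * f u =
    \sum_u (#|T|%:R - (deg e u)%:R) * f u.
  apply: eq_bigr => u _; rewrite -mulr_suml sumrB sum_adjR.
  by rewrite sumr_const /= -mulr_natl mulr1.
apply: (@le_trans _ _ (\sum_u \sum_v (1 - adjR u v) * X u ^+ 2)); last first.
  rewrite nonadj; apply: ler_sum => u _; rewrite expr2 mulrA.
  by apply: ler_piMl.
have sym : \sum_u \sum_v (1 - adjR u v) * X u ^+ 2 =
           \sum_u \sum_v (1 - adjR u v) * X v ^+ 2.
  rewrite exchange_big /=; apply: eq_bigr => u _; apply: eq_bigr => v _.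
  by rewrite adjRC.
suff : 2 * (S ^+ 2 - P) <= \sum_u \sum_v (1 - adjR u v) * X u ^+ 2 +
                       \sum_u \sum_v (1 - adjR u v) * X v ^+ 2 by rewrite -sym; lra.
rewrite S2 PE -sumrB mulr_sumr -big_split; apply: ler_sum => u _ /=.
rewrite -sumrB mulr_sumr -big_split; apply: ler_sum => v _ /=.
have := adjR_le1 u v; have := sqr_ge0 (X u - X v); nra.
Qed.

(** Cauchy-Schwarz, from the nonnegative sum of [X u * (D u - c) ^+ 2] at [c = P / S]. *)
Let XD2 : P ^+ 2 <= S * \sum_u X u * D u ^+ 2.
Proof.
have [S0|S_neq0] := eqVneq S 0.
  have : P = 0 by have := P_le; have := P_ge0; rewrite S0 expr0n /=; lra.
  by rewrite S0 mul0r => ->; rewrite expr0n.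
have h c : 0 <= \sum_u X u * D u ^+ 2 - 2 * c * P + c ^+ 2 * S.
  have -> : \sum_u X u * D u ^+ 2 - 2 * c * P + c ^+ 2 * S =
            \sum_u X u * (D u - c) ^+ 2.
    rewrite /P /S !mulr_sumr -sumrB -big_split; apply: eq_bigr => u _ /=; ring.
  by apply: sumr_ge0 => u _; rewrite mulr_ge0 ?sqr_ge0.
have {h} := mulr_ge0 S_ge0 (h (P / S)).
have -> : S * (\sum_u X u * D u ^+ 2 - 2 * (P / S) * P + (P / S) ^+ 2 * S) =
          S * (\sum_u X u * D u ^+ 2) - P ^+ 2 by field.
lra.
Qed.

(** With [x] and [y] the indicators of [uv] and [uw], the indicator of [x = y] is
    [2 * x * y + 1 - x - y]. Summed over edges [vw], the last two terms each give the sum of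
    [X u * D u ^+ 2]. *)
Let sum_inner : \sum_u X u * inner u = 2 * Tw + S * P - 2 * \sum_u X u * D u ^+ 2.
Proof.
have SP : S * P = \sum_u \sum_v \sum_w X u * X v * X w * adjR v w.
  rewrite mulr_suml; apply: eq_bigr => u _; rewrite PE mulr_sumr.
  apply: eq_bigr => v _; rewrite mulr_sumr; apply: eq_bigr => w _; ring.
have XDE : \sum_u X u * D u ^+ 2 =
    \sum_u \sum_v \sum_w X u * X v * X w * (adjR u v * adjR v w).
  rewrite [RHS]exchange_big /=; apply: eq_bigr => v _.
  rewrite expr2 mulrCA mulr_suml; apply: eq_bigr => u _.
  rewrite !mulr_sumr; apply: eq_bigr => w _; rewrite [adjR u v]adjRC; ring.
have XDE' : \sum_u X u * D u ^+ 2 =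
    \sum_u \sum_v \sum_w X u * X v * X w * (adjR u w * adjR v w).
  rewrite XDE; apply: eq_bigr => u _; rewrite [RHS]exchange_big /=.
  apply: eq_bigr => v _; apply: eq_bigr => w _; rewrite [adjR w v]adjRC; ring.
have -> : 2 * Tw + S * P - 2 * \sum_u X u * D u ^+ 2 =
    2 * Tw + S * P - \sum_u X u * D u ^+ 2 - \sum_u X u * D u ^+ 2 by ring.
rewrite {1}XDE XDE' SP /Tw mulr_sumr -big_split -!sumrB.
apply: eq_bigr => u _ /=; rewrite !mulr_sumr -big_split -!sumrB.
apply: eq_bigr => v _ /=; rewrite !mulr_sumr -big_split -!sumrB.
apply: eq_bigr => w _ /=; rewrite /adjR.
case: (e v w); case: (e u v); case: (e u w); rewrite /= ?eqxx /=; ring.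
Qed.

(** Averages [inner u] with weights [X u]. In [sum_inner], Cauchy-Schwarz bounds the squares below
    by [P ^+ 2 / S], and then [S ^+ 2 - S <= P] leaves at most [P * (2 - S)] besides the
    triangles. *)
Lemma weighted_partition (t : R) : 1 <= S -> 0 <= t -> 2 - S <= t ->
  exists u, inner u <= 2 * Tw + S ^+ 2 * t.
Proof.
move=> S1 t0 St.
have S_gt0 : 0 < S by lra.
have bound : \sum_u X u * inner u <= 2 * Tw + S ^+ 2 * t.
  rewrite sum_inner.
  suff : S * (S * P - 2 * \sum_u X u * D u ^+ 2) <= S * (P * t).
    rewrite ler_pM2l // => h.
    have : P * t <= S ^+ 2 * t by apply: ler_wpM2r.
    by move: h; set Z := \sum_u X u * D u ^+ 2; set Y := S ^+ 2 * t; lra.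
  move: XD2 P_ge P_ge0; set Z := \sum_u X u * D u ^+ 2 => h1 h2 h3.
  have h4 : P * (S ^+ 2 - 2 * P) <= P * (S * t).
    apply: ler_wpM2l => //.
    have : S * (2 - S) <= S * t by apply: ler_wpM2l.
    by move: h2; rewrite expr2; lra.
  have -> : S * (S * P - 2 * Z) = P * S ^+ 2 - 2 * (S * Z) by ring.
  have -> : S * (P * t) = P * (S * t) by ring.
  by move: h4; rewrite mulrBr; move: h1; rewrite expr2; lra.
(* Being nonnegative, the bound is at most [S] times itself as [1 <= S]; averaging needs this
   comparison. *)
have inner_ge0 : 0 <= 2 * Tw + S ^+ 2 * t.
  rewrite addr_ge0 ?mulr_ge0 ?sqr_ge0 ?ler0n //.
  by do 3 apply: sumr_ge0 => ? _; rewrite !mulr_ge0.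
set C := _ + _ in bound inner_ge0 *.
apply/existsP; apply: contraT => /existsPn h; exfalso.
have X0 u : X u * (inner u - C) = 0.
  have ge0 v : 0 <= X v * (inner v - C).
    by rewrite mulr_ge0 // subr_ge0 ltW // ltNge h.
  apply/eqP; rewrite eq_le ge0 andbT.
  apply: (@le_trans _ _ (\sum_v X v * (inner v - C))).
    by rewrite (bigD1 u) //= lerDl sumr_ge0.
  under eq_bigr do rewrite mulrBr.
  rewrite sumrB -mulr_suml -/S subr_le0; apply: (le_trans bound).
  by apply: ler_peMl.
move: S_gt0; rewrite /S big1 ?ltxx // => u _.
have /eqP := X0 u; rewrite mulf_eq0 subr_eq0 => /orP[/eqP //|/eqP eC].
by have := h u; rewrite eC lexx.
Qed.

End WeightedPartition.

(** * Falling factorials and Lipschitz bounds for the weight *)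

Lemma leq_ffact2r k m n : m <= n -> m ^_ k <= n ^_ k.
Proof.
elim: k m n => [|k IHk] m n mn //; rewrite !ffactnS leq_mul // IHk //; lia.
Qed.

Lemma ffact_leq_expn n k : n ^_ k <= n ^ k.
Proof.
rewrite ffact_prod -[X in _ <= n ^ X]card_ord -prod_nat_const.
by apply: leq_prod => i _; apply: leq_subr.
Qed.

(** The discrete derivative of the falling factorial. *)
Lemma ffact_lipschitz_step b m : m.+1 ^_ b <= m ^_ b + b * m ^_ b.-1.
Proof.
case: b => [|b] //=; rewrite ffactSS ffactnSr.
case: (leqP b m) => bm; last by rewrite ffact_small // muln0.
nia.
Qed.

(** Telescopes the discrete derivative; the factor [N] on both sides lets the exponent be [b]
    instead of [b.-1]. *)
Lemma ffact_lipschitz N b y y' : y' <= y <= N ->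
  N * y ^_ b <= N * y' ^_ b + b * N ^ b * (y - y').
Proof.
case/andP; elim: y => [|y IHy].
  by rewrite leqn0 => /eqP ->; rewrite subnn muln0 addn0.
rewrite leq_eqVlt => /orP[/eqP -> _|y'y yN].
  by rewrite subnn muln0 addn0.
have {}IHy := IHy y'y (ltnW yN).
rewrite subSn // mulnS addnCA.
apply: (@leq_trans (N * (y ^_ b + b * y ^_ b.-1))).
  by rewrite leq_mul2l ffact_lipschitz_step orbT.
rewrite mulnDr addnC leq_add //.
case: b {IHy} => [|b] /=; first by rewrite muln0.
rewrite mulnCA leq_mul2l expnS leq_mul2l.
apply/orP; right; apply/orP; right.
by apply: leq_trans (ffact_leq_expn _ _) _; apply: leq_expn2r; apply: ltnW.
Qed.

Lemma leq_weight a b x y y' : y <= y' -> weight a b x y <= weight a b x y'.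
Proof. by move=> yy'; rewrite leq_add // leq_mul // leq_ffact2r //; lia. Qed.

Lemma weight_lipschitz N a b x y y' : 0 < y' -> y' <= y <= N -> x <= N ->
  N * weight a b x y <= N * weight a b x y' + (a + b) * N ^ (a + b) * (y - y').
Proof.
move=> y'0 /andP[yy yN] xN.
have xk k : x.-1 ^_ k <= N ^ k.
  by apply: leq_trans (ffact_leq_expn _ _) _; apply: leq_expn2r; lia.
have dE : y.-1 - y'.-1 = y - y' by lia.
have yy1 : y'.-1 <= y.-1 <= N by lia.
have := ffact_lipschitz b yy1; have := ffact_lipschitz a yy1.
rewrite dE /weight expnD.
move: (xk a) (xk b) (y - y').
move: (x.-1 ^_ a) (x.-1 ^_ b) (y.-1 ^_ a) (y.-1 ^_ b) (y'.-1 ^_ a) (y'.-1 ^_ b).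
move: (N ^ a) (N ^ b) => Na Nb xa xb ya yb za zb hxa hxb d ha hb.
have h1 := leq_mul (leqnn xa) hb; have h2 := leq_mul (leqnn xb) ha.
have h3 : xa * (b * Nb * d) <= Na * (b * Nb * d) by rewrite leq_mul2r hxa orbT.
have h4 : xb * (a * Na * d) <= Nb * (a * Na * d) by rewrite leq_mul2r hxb orbT.
lia.
Qed.

Lemma weight_le N a b x y : x <= N -> y <= N -> weight a b x y <= 2 * N ^ (a + b).
Proof.
move=> xN yN; rewrite mul2n -addnn expnD; apply: leq_add.
  by apply: leq_mul; apply: leq_trans (ffact_leq_expn _ _) _; apply: leq_expn2r; lia.
by apply: leq_mul; apply: leq_trans (ffact_leq_expn _ _) _; apply: leq_expn2r; lia.
Qed.

(** These counts run over ordered tuples: for a symmetric irreflexive [e], a triangle counts six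
    times, an inner edge or a missing cross edge twice. *)
Definition triangles (T : finType) (e : rel T) : nat :=
  \sum_u \sum_v \sum_w (e u v && e u w && e v w).

Definition inner_pairs (T : finType) (e : rel T) (p : pred T) : nat :=
  \sum_u \sum_v (e u v && (p u == p v)).

Definition missing_pairs (T : finType) (e : rel T) (p : pred T) : nat :=
  \sum_u \sum_v (~~ e u v && (p u != p v)).

Lemma card_sum_nat (T : finType) (A : {set T}) : #|A| = \sum_x (x \in A).
Proof. by rewrite -sum1_card big_mkcond; apply: eq_bigr => x _; case: (x \in A). Qed.

Lemma sum_codeg (T : finType) (e : rel T) :
  \sum_u \sum_(v | e u v) #|nbhd e u :&: nbhd e v| = triangles e.
Proof.
apply: eq_bigr => u _; rewrite big_mkcond; apply: eq_bigr => v _.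
case: ifP => uv; last by rewrite big1.
by rewrite card_sum_nat; apply: eq_bigr => w _; rewrite !inE.
Qed.

Lemma deg_lt (T : finType) (e : rel T) u : irreflexive e -> deg e u < #|T|.
Proof.
move=> eI; rewrite -cardsT proper_card // properT; apply/eqP => /setP/(_ u).
by rewrite !inE eI.
Qed.

Section Stability.
Variables (a b k0 M : nat) (T : finType) (e : rel T).
Hypotheses (eS : symmetric e) (eI : irreflexive e).
Hypothesis k0_gt0 : 0 < k0.
(** In the application, [M] is the number of embeddings in a supposed counterexample, which exceeds
    that of every complete bipartite graph with nonempty parts. *)
Hypothesis M_max : forall x y, 0 < x -> 0 < y -> x + y = #|T| ->
  x * y * weight a b x y <= M.
Hypothesis M_big : #|T| ^ (a + b + 2) <= k0 * M.
Hypothesis M_le : 2 * M <= \sum_u \sum_(v | e u v) weight a b (deg e u) (deg e v).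
Hypothesis T_gt0 : 0 < #|T|.

Let n := #|T|.
Let K := 2 * k0.

(** Here [w0] is the weight after lowering [deg v] to at most [n - deg u], as for an edge in no
    triangle. The drop is at most the codegree, and [weight_lipschitz] prices it. The last bound is
    crude and fixes [K]. *)
Lemma edge_weight_bound u v : e u v -> exists w0,
  [/\ n * weight a b (deg e u) (deg e v) <=
        n * w0 + (a + b) * n ^ (a + b) * #|nbhd e u :&: nbhd e v|,
      deg e u * (n - deg e u) * w0 <= M & n ^ 2 * w0 <= K * M].
Proof.
move=> uv.
have ux : deg e u < n by apply: deg_lt.
have vy : deg e v < n by apply: deg_lt.
have u0 : 0 < deg e u by apply/card_gt0P; exists v; rewrite inE.
have v0 : 0 < deg e v by apply/card_gt0P; exists u; rewrite inE eS.
have cod : deg e u + deg e v <= n + #|nbhd e u :&: nbhd e v|.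
  by rewrite -cardsUI leq_add2r max_card.
move: cod ux vy u0 v0; set x := deg e u; set y := deg e v; set c := #|_ :&: _|.
move=> cod ux vy u0 v0.
pose y' := minn y (n - x).
exists (weight a b x y'); split.
- apply: leq_trans (weight_lipschitz _ _ (y' := y') _ _ _) _; rewrite /y'; try lia.
  by rewrite leq_add2l leq_mul2l; apply/orP; right; lia.
- apply: (@leq_trans (x * (n - x) * weight a b x (n - x))).
    by rewrite leq_mul2l leq_weight ?orbT // geq_minr.
  by apply: M_max; rewrite -/n; lia.
- apply: (@leq_trans (n ^ 2 * (2 * n ^ (a + b)))).
    by rewrite leq_mul2l weight_le ?orbT // /y'; lia.
  by rewrite mulnCA -expnD addnC /K -mulnA leq_mul2l M_big orbT.
Qed.

Import Order.TTheory GRing.Theory Num.Theory.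
Local Open Scope ring_scope.

Let N : rat := n%:R.
(* Caro-Wei weights, capped so that few triangles also have small total weight. *)
Let X u : rat := Num.min (N - (deg e u)%:R)^-1 (K%:R / N).
Let S := \sum_u X u.
Let Tri : rat := (triangles e)%:R.

Let N_gt0 : 0 < N. Proof. by rewrite ltr0n. Qed.
Let K_gt0 : (0 < K)%N. Proof. by rewrite muln_gt0. Qed.

Let codeg_gt0 u : 0 < N - (deg e u)%:R.
Proof. by rewrite subr_gt0 ltr_nat; apply: deg_lt. Qed.

Let X_ge u : N^-1 <= X u.
Proof.
rewrite le_min lef_pV2 ?posrE ?codeg_gt0 // lerBlDr lerDl ler0n /=.
by rewrite -[leLHS]mul1r ler_pM2r ?invr_gt0 // ler1n.
Qed.

Let X_ge0 u : 0 <= X u.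
Proof. by apply: le_trans (X_ge u); rewrite invr_ge0 ltW. Qed.

Let X_le u : X u <= K%:R / N. Proof. by rewrite ge_min lexx orbT. Qed.

Let X_deg u : (N - (deg e u)%:R) * X u <= 1.
Proof.
by rewrite mulrC -ler_pdivlMr ?codeg_gt0 // mul1r ge_min lexx.
Qed.

Let S_ge1 : 1 <= S.
Proof.
apply: (@le_trans _ _ (\sum_(u : T) N^-1)); last by apply: ler_sum.
by rewrite sumr_const -[_ *+ _]mulr_natl mulfV ?gt_eqF.
Qed.

Let S_leK : S <= K%:R.
Proof.
apply: (@le_trans _ _ (\sum_(u : T) K%:R / N)); first by apply: ler_sum.
by rewrite sumr_const -[_ *+ _]mulr_natl mulrC -mulrA mulVf ?gt_eqF ?mulr1.
Qed.

(** Each of the [deg u] edges at [u] receives the share [M * X u / deg u]. The two cases of the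
    minimum in [X u] match the last two bounds of [edge_weight_bound]. *)
Let vertex_weight u :
  N * (\sum_(v | e u v) weight a b (deg e u) (deg e v))%:R <=
  N * M%:R * X u +
  (a + b)%:R * N ^+ (a + b) * (\sum_(v | e u v) #|nbhd e u :&: nbhd e v|)%:R.
Proof.
rewrite !natr_sum !mulr_sumr.
have [d0|d0] := posnP (deg e u).
  have he v : e u v = false by have := cards0_eq d0 => /setP/(_ v); rewrite !inE.
  rewrite !big_pred0 // addr0 !mulr_ge0 // ltW //.
have d0R : 0 < (deg e u)%:R :> rat by rewrite ltr0n.
have -> : N * M%:R * X u = \sum_(v | e u v) N * M%:R * X u / (deg e u)%:R.
  rewrite sumr_const; set z := _ / _.
  have -> : #|[pred v | e u v]| = deg e u by apply: eq_card => v; rewrite !inE.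
  by rewrite -(mulr_natr z) /z mulfVK ?gt_eqF.
rewrite -big_split; apply: ler_sum => v uv /=.
have [w0 [h1 h2 h3]] := edge_weight_bound uv.
apply: (@le_trans _ _ (N * w0%:R + (a + b)%:R * N ^+ (a + b) * #|nbhd e u :&: nbhd e v|%:R)).
  by rewrite -natrX -!natrM -natrD ler_nat.
rewrite lerD2r -!mulrA ler_pM2l // mulrA ler_pdivlMr //.
have dN : (deg e u)%:R <= N by rewrite ltW // -subr_gt0.
rewrite /X minElt; case: ifP => _.
  rewrite ler_pdivlMr ?codeg_gt0 // -natrB; last by rewrite -(ler_nat rat).
  by rewrite -!natrM ler_nat; move: h2; lia.
rewrite mulrA ler_pdivlMr //.
apply: (@le_trans _ _ (w0%:R * N * N)); first by rewrite -!mulrA ler_wpM2l // ler_wpM2r // ltW.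
by rewrite -!natrM ler_nat; move: h3; rewrite expnS expn1; lia.
Qed.

(** The vertex bounds sum to a comparison of [2 * M] with [M * S], up to a term linear in the number
    of triangles; [M_big] then allows dividing by [M]. *)
Let S_near2 : 2 - S <= (a + b)%:R * k0%:R * Tri / N ^+ 3.
Proof.
have total : N * (2 * M%:R) <= N * M%:R * S + (a + b)%:R * N ^+ (a + b) * Tri.
  apply: (@le_trans _ _ (N * (\sum_u \sum_(v | e u v) weight a b (deg e u) (deg e v))%:R)).
    by rewrite ler_pM2l // -natrM ler_nat.
  rewrite natr_sum mulr_sumr /S /Tri -sum_codeg natr_sum !mulr_sumr -big_split.
  by apply: ler_sum => u _; apply: vertex_weight.
have Nab : 0 < N ^+ (a + b) by rewrite exprn_gt0.
rewrite ler_pdivlMr ?exprn_gt0 //.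
have [S2|S2] := lerP (2 - S) 0.
  apply: (@le_trans _ _ 0); first by rewrite mulr_le0_ge0 // exprn_ge0 // ltW.
  by rewrite !mulr_ge0.
have Mb : N ^+ (a + b) * N ^+ 2 <= k0%:R * M%:R.
  by rewrite -exprD -natrX -natrM ler_nat.
rewrite -(ler_pM2l Nab).
have -> : N ^+ (a + b) * ((2 - S) * N ^+ 3) =
          N * (2 - S) * (N ^+ (a + b) * N ^+ 2) by ring.
apply: (@le_trans _ _ (N * (2 - S) * (k0%:R * M%:R))).
  by rewrite ler_pM2l // mulr_gt0.
have -> : N * (2 - S) * (k0%:R * M%:R) = k0%:R * (N * (2 * M%:R) - N * M%:R * S) by ring.
have -> : N ^+ (a + b) * ((a + b)%:R * k0%:R * Tri) =
          k0%:R * ((a + b)%:R * N ^+ (a + b) * Tri) by ring.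
by rewrite ler_pM2l ?ltr0n // lerBlDl.
Qed.

(** The cut is the neighbourhood of the vertex found by averaging. As [N^-1 <= X u <= K / N] and
    [S <= K], weighted counts turn into ordinary ones: [2 * K ^ 3] stems from [Tw], the other
    summand from the defect [2 - S]. *)
Lemma stability (k : nat) :
  (k * (2 * K ^ 3 + K ^ 2 * (a + b) * k0) * triangles e <= n ^ 3)%N ->
  exists p : pred T, (k * inner_pairs e p <= n ^ 2)%N.
Proof.
move=> kTri; pose t := (a + b)%:R * k0%:R * Tri / N ^+ 3.
have t0 : 0 <= t by rewrite !mulr_ge0 // invr_ge0 exprn_ge0 // ltW.
have [u] := weighted_partition eS X_ge0 X_deg S_ge1 t0 S_near2.
set in_u := \sum_v _; set Tw := \sum_u _; rewrite -/S => hu; exists (e u).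
have in_le : (inner_pairs e (e u))%:R / N ^+ 2 <= in_u.
  rewrite natr_sum mulr_suml; apply: ler_sum => v _; rewrite natr_sum mulr_suml.
  apply: ler_sum => w _; rewrite mulrC ler_wpM2r // expr2 invfM.
  by rewrite ler_pM // invr_ge0 ltW.
have Tw_le : Tw <= (K%:R / N) ^+ 3 * Tri.
  rewrite /Tri natr_sum mulr_sumr; apply: ler_sum => v _.
  rewrite natr_sum mulr_sumr; apply: ler_sum => w _.
  rewrite natr_sum mulr_sumr; apply: ler_sum => z _.
  have -> : (e v w && e v z && e w z)%:R = (e v w)%:R * (e v z)%:R * (e w z)%:R :> rat.
    by rewrite -!natrM !mulnb.
  by rewrite ler_wpM2r ?mulr_ge0 // exprS expr2 mulrA !ler_pM ?mulr_ge0.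
have S2 : S ^+ 2 * t <= K%:R ^+ 2 * t.
  by rewrite ler_wpM2r // ler_pXn2r // nnegrE // (le_trans _ S_ge1).
have : (inner_pairs e (e u))%:R / N ^+ 2 <= 2 * ((K%:R / N) ^+ 3 * Tri) + K%:R ^+ 2 * t by lra.
rewrite ler_pdivrMr ?exprn_gt0 // => h.
rewrite -(ler_nat rat) natrM.
apply: (le_trans (ler_wpM2l (ler0n _ k) h)).
have -> : k%:R * ((2 * ((K%:R / N) ^+ 3 * Tri) + K%:R ^+ 2 * t) * N ^+ 2) =
   (k * (2 * K ^ 3 + K ^ 2 * (a + b) * k0) * triangles e)%N%:R / N.
  have cast (kk x2 x3 ab kz c : nat) : (kk * (2 * x3 + x2 * ab * kz) * c)%N%:R =
      kk%:R * (2 * x3%:R + x2%:R * ab%:R * kz%:R) * c%:R :> rat.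
    by rewrite !natrM natrD !natrM.
  have alg (kk KK NN TT ab kz : rat) : NN != 0 ->
      kk * ((2 * ((KK / NN) ^+ 3 * TT) + KK ^+ 2 * (ab * kz * TT / NN ^+ 3)) * NN ^+ 2)
      = kk * (2 * KK ^+ 3 + KK ^+ 2 * ab * kz) * TT / NN by move=> NN0; field.
  by rewrite alg ?gt_eqF // cast !natrX.
by rewrite ler_pdivrMr // -natrM ler_nat -expnSr.
Qed.

End Stability.

(** * Cuts *)

(** Separates the pairs at [x], in order to compare cuts that differ only in the place of [x]. *)
Lemma double_sum_at (T : finType) (f : T -> T -> nat) x :
  (forall u v, f u v = f v u) -> f x x = 0 ->
  \sum_u \sum_v f u v =
  2 * \sum_v f x v + \sum_(u | u != x) \sum_(v | v != x) f u v.
Proof.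
move=> fC fxx; rewrite (bigD1 x) //= mul2n -addnn -addnA; congr (_ + _).
rewrite [X in _ = X + _](bigD1 x) //= fxx add0n -big_split /=.
by apply: eq_bigr => u ux; rewrite (bigD1 x) //= fC.
Qed.

Section Cuts.
Variables (T : finType) (e : rel T).
Hypotheses (eS : symmetric e) (eI : irreflexive e).
Implicit Types p : pred T.

Definition inner_deg p x := #|[set y in nbhd e x | p x == p y]|.
Definition cross_deg p x := #|[set y in nbhd e x | p x != p y]|.
Definition opposite p x := [set y | p x != p y].
Definition missing_deg p x := #|[set y in opposite p x | ~~ e x y]|.

Lemma inner_pairsE p : inner_pairs e p = \sum_x inner_deg p x.
Proof.
apply: eq_bigr => x _; rewrite /inner_deg card_sum_nat; apply: eq_bigr => y _.
by rewrite !inE.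
Qed.

Lemma missing_pairsE p : missing_pairs e p = \sum_x missing_deg p x.
Proof.
apply: eq_bigr => x _; rewrite /missing_deg card_sum_nat; apply: eq_bigr => y _.
by rewrite !inE andbC.
Qed.

Lemma exists_min_inner_pairs :
  exists p, forall q, inner_pairs e p <= inner_pairs e q.
Proof.
(* Cuts are encoded in a finite type so that a minimum exists. *)
pose q0 : {ffun T -> bool} := [ffun=> true].
have [f _ fmin] := @arg_minnP _ q0 predT (fun f : {ffun T -> bool} => inner_pairs e f) isT.
exists f => q; have := fmin [ffun x => q x] isT; congr (_ <= _).
by apply: eq_bigr => u _; apply: eq_bigr => v _; rewrite !ffunE.
Qed.

(** Moving [x] to the other part swaps its inner and cross neighbours and affects no other pair. *)
Lemma inner_deg_min p x : (forall q, inner_pairs e p <= inner_pairs e q) ->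
  inner_deg p x <= cross_deg p x.
Proof.
move=> /(_ (fun y => if y == x then ~~ p x else p y)); rewrite /inner_pairs.
rewrite !(@double_sum_at _ _ x); first last.
- by rewrite eI.
- by move=> u v; rewrite eS [p v == _]eq_sym.
- by rewrite eI.
- by move=> u v; rewrite eS [X in _ && X]eq_sym.
rewrite [X in _ <= _ + X](eq_bigr (fun u => \sum_(v | v != x) (e u v && (p u == p v)))); last first.
  by move=> u /negPf ->; apply: eq_bigr => v /negPf ->.
rewrite leq_add2r leq_pmul2l // /inner_deg /cross_deg !card_sum_nat.
congr (_ <= _); apply: eq_bigr => y _; rewrite !inE //.
rewrite eqxx; case: (y =P x) => [->|_]; first by rewrite eI.
by case: (p x); case: (p y).
Qed.

Lemma missing_between p (A B : {set T}) :
  (forall y z, y \in A -> z \in B -> p y != p z) ->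
  #|A| * #|B| <= \sum_(y in A) #|[set z in B | e y z]| + missing_pairs e p.
Proof.
move=> AB.
have -> : #|A| * #|B| = \sum_(y in A) (#|[set z in B | e y z]| + #|[set z in B | ~~ e y z]|).
  rewrite -sum_nat_const; apply: eq_bigr => y _.
  rewrite -(cardsID [set z | e y z] B); congr (_ + _); apply: eq_card => z.
    by rewrite !inE.
  by rewrite !inE andbC.
rewrite big_split leq_add2l missing_pairsE /= [leqLHS]big_mkcond.
apply: leq_sum => y _; case: ifP => // yA; apply: subset_leq_card.
by apply/subsetP => z; rewrite !inE => /andP[zB ->]; rewrite AB.
Qed.

End Cuts.

Lemma card_ffun_two_fixed (U T : finType) (z z' : U) (x y : T) : z != z' ->
  #|[set f : {ffun U -> T} | (f z == x) && (f z' == y)]| <= #|T| ^ #|U|.-2.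
Proof.
move=> zz; pose W := {u : U | u \notin [set z; z']}.
pose res (f : {ffun U -> T}) : {ffun W -> T} := [ffun w => f (val w)].
have resi : {in [set f : {ffun U -> T} | (f z == x) && (f z' == y)] &, injective res}.
  move=> f g /[!inE] /andP[/eqP fz /eqP fz'] /andP[/eqP gz /eqP gz'] /ffunP h.
  apply/ffunP => u; have [uz|uz] := boolP (u \in [set z; z']).
    by move: uz; rewrite !inE => /orP[]/eqP ->; rewrite ?fz ?fz' ?gz ?gz'.
  by have := h (exist _ u uz); rewrite !ffunE.
rewrite -(card_in_imset resi); apply: leq_trans (max_card _) _.
rewrite card_ffun; apply: eq_leq; congr (_ ^ _).
rewrite card_sig; have := cardsC [set z; z']; rewrite cards2 zz /=.
rewrite (_ : #|~: [set z; z']| = #|[pred u | u \notin [set z; z']]|); last first.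
  by apply: eq_card => u; rewrite !inE.
lia.
Qed.

(** * Gain from inner edges against loss from missing ones *)

Section InnerMissing.
Variables (a b : nat) (T : finType) (e : rel T) (p : pred T).
Hypotheses (eS : symmetric e) (eI : irreflexive e).
Let n := #|T|.
Let U := (option 'I_a + option 'I_b)%type.
Let r := @double_star_rel a b.

Let card_U : #|{: U}| = a + b + 2.
Proof. by rewrite card_sum !card_option !card_ord; lia. Qed.

Let r_neq (z z' : U) : r z z' -> z != z'.
Proof. by apply: contraTneq => ->; case: z' => [[?|]|[?|]]. Qed.

Let uses_inner : {set {ffun U -> T}} :=
  [set f in embeddings r e | [exists z, exists z', r z z' && (p (f z) == p (f z'))]].

(** Choose an edge of the double star, the inner pair it is sent to, and the images of the other
    [a + b] vertices. *)
Lemma card_uses_inner :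
  #|uses_inner| <= (a + b + 2) ^ 2 * (inner_pairs e p * n ^ (a + b)).
Proof.
pose hits (zz : U * U) := [set f : {ffun U -> T} |
  r zz.1 zz.2 && (e (f zz.1) (f zz.2) && (p (f zz.1) == p (f zz.2)))].
have sub : uses_inner \subset \bigcup_zz hits zz.
  apply/subsetP => f /setIdP[/embeddingsP[_ h] /existsP[z /existsP[z' /andP[zz pz]]]].
  by apply/bigcupP; exists (z, z'); rewrite // inE /= zz pz h.
apply: leq_trans (subset_leq_card sub) _.
apply: (@leq_trans (\sum_zz #|hits zz|)).
  elim/big_rec2: _ => [|zz m A _ IH]; first by rewrite cards0.
  by apply: leq_trans (leq_card_setU _ _) _; rewrite leq_add2l.
have -> : (a + b + 2) ^ 2 = #|{: U * U}| by rewrite card_prod card_U mulnn.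
rewrite -sum_nat_const; apply: leq_sum => -[z z'] _.
have [zz|zz] := boolP (r z z'); last by rewrite eq_card0 // => f; rewrite inE /= (negPf zz).
rewrite -sum1_card (partition_big (fun f : {ffun U -> T} => (f z, f z')) predT) //=.
rewrite -(pair_big predT predT (fun x y => \sum_(f in hits (z, z') | (f z, f z') == (x, y)) 1)) /=.
rewrite big_distrl; apply: leq_sum => x _; rewrite big_distrl; apply: leq_sum => y _ /=.
have [xy|xy] := boolP (e x y && (p x == p y)); last first.
  rewrite big1 // => f /andP[/[!inE] /= /andP[_ hf] /eqP[fz fz']].
  by move: hf; rewrite fz fz' (negPf xy).
rewrite mul1n; have := card_ffun_two_fixed x y (r_neq zz).
rewrite card_U addn2 /=; apply: leq_trans.
rewrite sum1dep_card; apply/subset_leq_card/subsetP => f.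
by rewrite !inE => /andP[_]; rewrite xpair_eqE.
Qed.

(** Embeddings without inner edges live in the complete bipartite graph of the cut, and each missing
    pair rules out the at least [W] embeddings centred on it. *)
Lemma card_two_parts_split W :
  (forall u v, p u != p v -> W <= #|centred (two_parts p) a b u v|) ->
  #|embeddings r e| + missing_pairs e p * W <=
  #|embeddings r (two_parts p)| +
    (a + b + 2) ^ 2 * (inner_pairs e p * n ^ (a + b)).
Proof.
move=> hW; pose tp := embeddings r (two_parts p).
pose on_e := [set f : {ffun U -> T} | e (f (inl None)) (f (inr None))].
have e1 : #|embeddings r e| <= #|tp :&: on_e| + #|uses_inner|.
  apply: leq_trans (leq_card_setU _ _); apply/subset_leq_card/subsetP => f fe.
  have /embeddingsP[fi h] := fe.
  rewrite in_setU; have [//|nu] := boolP (f \in uses_inner); first by rewrite orbT.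
  rewrite orbF in_setI [f \in on_e]inE h // andbT.
  apply/embeddingsP; split=> // z z' zz; apply: contraNT nu => /negPn pz.
  by rewrite inE fe; apply/existsP; exists z; apply/existsP; exists z'; rewrite zz.
have e2 : missing_pairs e p * W <= #|tp :\: on_e|.
  rewrite -sum1_card.
  rewrite (partition_big (fun f : {ffun U -> T} => (f (inl None), f (inr None))) predT) //=.
  rewrite -(pair_big predT predT (fun u v =>
    \sum_(f in tp :\: on_e | (f (inl None), f (inr None)) == (u, v)) 1)) /=.
  rewrite big_distrl; apply: leq_sum => u _; rewrite big_distrl; apply: leq_sum => v _.
  have [/andP[nuv uv]|_] := boolP (~~ e u v && (p u != p v)); last by rewrite /= mul0n.
  rewrite /= mul1n sum1dep_card; apply: leq_trans (hW u v uv) _.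
  apply/subset_leq_card/subsetP => f /setIdP[ftp /andP[/eqP fu /eqP fv]].
  apply/setIdP; rewrite xpair_eqE fu fv !eqxx; split=> //; apply/setDP; split=> //.
  by rewrite inE fu fv.
apply: leq_trans (leq_add e1 e2) _; rewrite -/tp -(cardsID on_e tp) addnAC.
by rewrite leq_add2l; apply: card_uses_inner.
Qed.

End InnerMissing.

(** Every factor of [x.-1 ^_ c] is at least [x / 2]. *)
Lemma expn_le_ffact n k x c : 2 * c <= x -> n <= k * x ->
  n ^ c <= (2 * k) ^ c * x.-1 ^_ c.
Proof.
move=> cx nx; rewrite ffact_prod -[X in n ^ X]card_ord -[X in (2 * k) ^ X]card_ord.
rewrite -!prod_nat_const -big_split; apply: leq_prod => i _ /=.
apply: leq_trans nx _; rewrite mulnAC mulnC leq_mul2r; apply/orP; right.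
by have := ltn_ord i; lia.
Qed.

Lemma balanced_weight a b : exists n1 k0, 0 < k0 /\ forall n, n1 <= n ->
  exists x y, [/\ 0 < x, 0 < y, x + y = n &
    n ^ (a + b + 2) <= k0 * (x * y * weight a b x y)].
Proof.
(* For such [n] both halves are at least [n / 3], hence the factor 9, and large enough for
   [expn_le_ffact] with [k = 3], hence the powers. *)
exists (6 * (a + b) + 6), (9 * (2 * 3) ^ a * (2 * 3) ^ b); split.
  by rewrite !muln_gt0 !expn_gt0.
move=> n nn; exists n./2, (n - n./2).
have nE := odd_double_half n.
have [x0 y0 xy] : [/\ 0 < n./2, 0 < n - n./2 & n./2 + (n - n./2) = n] by split; lia.
split=> //; move: xy x0 y0; set x := n./2; set y := n - x => xy x0 y0.
have hx : n <= 3 * x by lia.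
have hy : n <= 3 * y by lia.
have ha := @expn_le_ffact n 3 x a ltac:(lia) hx.
have hb := @expn_le_ffact n 3 y b ltac:(lia) hy.
apply: (@leq_trans (((2 * 3) ^ a * x.-1 ^_ a) * ((2 * 3) ^ b * y.-1 ^_ b) * (3 * x * (3 * y)))).
  by rewrite !expnD expnS expn1; do 3 apply: leq_mul => //.
rewrite /weight; move: ((2 * 3) ^ a) ((2 * 3) ^ b) (x.-1 ^_ a) (y.-1 ^_ b).
move: (y.-1 ^_ a * x.-1 ^_ b) => W A1 B1 A2 B2.
have -> : A1 * A2 * (B1 * B2) * (3 * x * (3 * y)) =
          9 * A1 * B1 * (x * y * (A2 * B2)) by ring.
by rewrite leq_mul2l; apply/orP; right; rewrite leq_mul2l leq_addr orbT.
Qed.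

Lemma card_embeddings_weight a b (T : finType) (e : rel T) : symmetric e ->
  2 * #|embeddings (@double_star_rel a b) e| <=
  \sum_u \sum_(v | e u v) weight a b (deg e u) (deg e v).
Proof.
move=> eS; rewrite mul2n -addnn.
have h := @card_embeddings_le T e a b eS.
have h' : #|embeddings (@double_star_rel a b) e| <=
    \sum_u \sum_(v | e u v) (deg e v).-1 ^_ a * (deg e u).-1 ^_ b.
  apply: leq_trans h _; rewrite (exchange_big_dep predT) //=.
  by apply: leq_sum => u _; under eq_bigl => v do rewrite eS.
apply: leq_trans (leq_add h h') _; rewrite -big_split; apply: leq_sum => u _ /=.
by rewrite -big_split.
Qed.

(** Turns a lower bound of order [n ^ (a + b + 2)] on the embeddings into quadratically many
    edges. *)
Lemma card_embeddings_crude a b (T : finType) (e : rel T) : symmetric e ->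
  #|embeddings (@double_star_rel a b) e| <= #|T| ^ (a + b) * \sum_u deg e u.
Proof.
move=> eS; apply: leq_trans (card_embeddings_le _ _ eS) _.
rewrite big_distrr; apply: leq_sum => u _ /=.
rewrite mulnC -sum_nat_const.
under [leqRHS]eq_bigl => v do rewrite inE.
apply: leq_sum => v _; rewrite expnD.
by apply: leq_mul; apply: leq_trans (ffact_leq_expn _ _) _; apply: leq_expn2r;
  apply: leq_trans (leq_pred _) (max_card _).
Qed.

(** * Sizes of the parts of a cut *)

Section CutSizes.
Variables (T : finType) (e : rel T) (p : pred T).
Let n := #|T|.

Lemma card_same_part x : #|[set y | p x == p y]| = n - #|opposite p x|.
Proof.
rewrite /n -(cardsC (opposite p x)) addKn; apply: eq_card => y.
by rewrite !inE negbK.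
Qed.

Lemma opposite_same x y : p x = p y -> opposite p x = opposite p y.
Proof. by move=> xy; apply/setP => z; rewrite !inE xy. Qed.

Lemma sum_opposite x :
  \sum_u #|opposite p u| = 2 * (#|opposite p x| * (n - #|opposite p x|)).
Proof.
rewrite (bigID (mem (opposite p x))) /= mul2n -addnn; congr (_ + _).
  rewrite -sum_nat_const; apply: eq_bigr => u; rewrite inE => xu.
  rewrite -card_same_part; apply: eq_card => y; rewrite !inE.
  by move: xu; case: (p x); case: (p u); case: (p y).
rewrite mulnC -card_same_part -sum_nat_const; apply: eq_big => u.
  by rewrite !inE negbK.
by rewrite !inE negbK => /eqP/opposite_same ->.
Qed.

Lemma sum_deg_le : \sum_u deg e u <= inner_pairs e p + \sum_u #|opposite p u|.
Proof.
rewrite inner_pairsE -big_split; apply: leq_sum => u _ /=.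
rewrite -(cardsID [set y | p u == p y] (nbhd e u)) leq_add //.
  by rewrite /inner_deg; apply: eq_leq; apply: eq_card => y; rewrite !inE.
by apply/subset_leq_card/subsetP => y; rewrite !inE => /andP[].
Qed.

(** If edges are many and few of them are inner, a constant fraction crosses the cut, and a small
    part could not carry that many. *)
Lemma card_opposite_ge k0 x : 0 < n -> n ^ 2 <= k0 * \sum_u deg e u ->
  2 * k0 * inner_pairs e p <= n ^ 2 -> n <= 4 * k0 * #|opposite p x|.
Proof.
move=> n0 h1 h2; have := sum_deg_le; rewrite (sum_opposite x).
have : #|opposite p x| <= n by apply: max_card.
move: h1 h2; set I := inner_pairs e p; set o := #|_|; set D := \sum_u _.
rewrite -mulnn => h1 h2 on h3.
have h4 : n * n <= n * (4 * k0 * o).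
  have : 2 * (n * n) <= 2 * (k0 * (I + 2 * (o * (n - o)))).
    rewrite leq_mul2l /=; apply: leq_trans h1 _; rewrite leq_mul2l h3 orbT //.
  have : o * (n - o) <= o * n by rewrite leq_mul2l leq_subr orbT.
  move: (o * (n - o)) => q hq hI.
  have : k0 * q <= k0 * (o * n) by rewrite leq_mul2l hq orbT.
  lia.
by rewrite leq_pmul2l in h4.
Qed.

End CutSizes.

Section MissingVersusInner.
Variables (a b k1 : nat) (T : finType) (e : rel T) (p : pred T).
Hypotheses (eS : symmetric e) (eI : irreflexive e).
Let n := #|T|.
Hypothesis n_big : 2 * k1 * (a + b + 1) <= n.
Hypothesis part_big : forall x, n <= k1 * #|opposite p x|.
Hypothesis better : #|embeddings (@double_star_rel a b) (two_parts p)| <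
                    #|embeddings (@double_star_rel a b) e|.
Hypothesis n_gt0 : 0 < n.

Lemma missing_lt_inner :
  missing_pairs e p < (2 * k1) ^ (a + b) * (a + b + 2) ^ 2 * inner_pairs e p.
Proof.
have k1_gt0 : 0 < k1.
  have [x _] : exists x : T, x \in T by apply/card_gt0P.
  by have := part_big x; case: (k1) => //; rewrite mul0n leqNgt n_gt0.
have centre_big u v : p u != p v ->
    n ^ (a + b) <= (2 * k1) ^ (a + b) * #|centred (two_parts p) a b u v|.
  move=> uv; rewrite card_centred_two_parts // !expnD mulnACA.
  have dE x : nbhd (two_parts p) x = opposite p x by [].
  rewrite !dE; apply: leq_mul; apply: expn_le_ffact => //.
    by have := part_big u; nia.
  by have := part_big v; nia.
set c := (2 * k1) ^ (a + b) in centre_big *.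
have c0 : 0 < c by rewrite expn_gt0 muln_gt0 k1_gt0.
(* The quotient rounded up, so that [n ^ (a + b) <= c * W]. *)
pose W := (n ^ (a + b) + c - 1) %/ c.
have hW u v : p u != p v -> W <= #|centred (two_parts p) a b u v|.
  by move=> /centre_big h; rewrite -ltnS ltn_divLR //; lia.
have cW : n ^ (a + b) <= c * W.
  by have := ltn_pmod (n ^ (a + b) + c - 1) c0; have := divn_eq (n ^ (a + b) + c - 1) c; rewrite -/W; lia.
have := card_two_parts_split e hW; rewrite -/n.
have nab : 0 < n ^ (a + b) by rewrite expn_gt0 n_gt0.
move: better; set E1 := #|_|; set E2 := #|_|.
set I := inner_pairs e p; set m := missing_pairs e p => h1 h2.
rewrite -(ltn_pmul2r nab).
apply: (@leq_ltn_trans (c * (m * W))).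
  by rewrite mulnCA leq_mul2l cW orbT.
have : m * W < (a + b + 2) ^ 2 * (I * n ^ (a + b)) by lia.
by rewrite -(ltn_pmul2l c0) !mulnA.
Qed.

End MissingVersusInner.

Lemma leq_sum_sub_card (T : finType) (e : rel T) (A A' B B' : {set T}) :
  A \subset A' -> B \subset B' ->
  \sum_(x in A) #|[set y in B | e x y]| <= \sum_(x in A') #|[set y in B' | e x y]|.
Proof.
move=> sA sB; rewrite [leqLHS]big_mkcond [leqRHS]big_mkcond; apply: leq_sum => x _.
case: ifP => // xA; rewrite (subsetP sA) //; apply/subset_leq_card/subsetP => y.
by rewrite !inE => /andP[/(subsetP sB) -> ->].
Qed.

Lemma triangles_le k (T : finType) (e : rel T) :
  (forall x, k * \sum_(y in nbhd e x) #|[set z in nbhd e x | e y z]| <= #|T| ^ 2) ->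
  k * triangles e <= #|T| ^ 3.
Proof.
move=> h; rewrite -sum_codeg big_distrr /= [#|T| ^ 3]expnS -sum_nat_const.
apply: leq_sum => x _; apply: leq_trans (h x).
rewrite leq_mul2l; apply/orP; right; apply: eq_leq.
apply: eq_big => y; first by rewrite inE.
by move=> _; apply: eq_card => z; rewrite !inE.
Qed.

(** * Inner edges of an optimal cut *)

Section Cleaning.
Variables (T : finType) (e : rel T) (p : pred T).
Hypotheses (eS : symmetric e) (eI : irreflexive e).
Let n := #|T|.

(** If [x] had more than [n / k] inner neighbours, it would have as many cross neighbours. Few pairs
    between the two sets are missing, so the neighbourhood of [x] would contain too many edges. *)
Lemma inner_deg_small k x : (forall q, inner_pairs e p <= inner_pairs e q) ->
  2 * k ^ 2 * \sum_(y in nbhd e x) #|[set z in nbhd e x | e y z]| <= n ^ 2 ->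
  2 * k ^ 2 * missing_pairs e p <= n ^ 2 ->
  k * inner_deg e p x <= n.
Proof.
move=> pmin sparse miss; rewrite leqNgt; apply/negP => lt.
have := inner_deg_min eS eI x pmin; rewrite /cross_deg /inner_deg in lt *.
set A := [set y in _ | _] in lt *; set B := [set y in _ | _] => AB.
have AB_miss : #|A| * #|B| <= \sum_(y in A) #|[set z in B | e y z]| + missing_pairs e p.
  apply: missing_between => y z; rewrite !inE => /andP[_ /eqP <-] /andP[_ ->] //.
have sub : \sum_(y in A) #|[set z in B | e y z]| <=
           \sum_(y in nbhd e x) #|[set z in nbhd e x | e y z]|.
  by apply: leq_sum_sub_card; apply/subsetP => y; rewrite !inE => /andP[].
move: AB_miss sub sparse miss; move: (\sum_(y in A) _) (\sum_(y in nbhd e x) _).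
move: (missing_pairs e p) => m s t h1 h2 h3 h4.
have : n * n < k * #|A| * (k * #|B|).
  apply: (@leq_trans (k * #|A| * (k * #|A|))); first by apply: ltn_mul.
  by rewrite !leq_mul2l AB !orbT.
rewrite mulnn (_ : k * #|A| * (k * #|B|) = k ^ 2 * (#|A| * #|B|)); last by ring.
have : k ^ 2 * (#|A| * #|B|) <= k ^ 2 * (t + m).
  by rewrite leq_mul2l; apply/orP; right; lia.
lia.
Qed.

(** The common neighbours [Q] across the cut have few edges to the part of [x] and [y], yet few
    pairs are missing there; so [Q] fills at most half of the opposite part. Each vertex of the
    other half misses [x] or [y]. *)
Lemma inner_edge_missing k1 x y : 0 < n ->
  (forall x, n <= k1 * #|opposite p x|) -> p x = p y ->
  4 * k1 ^ 2 * \sum_l #|[set q in nbhd e x :&: nbhd e y | e l q]| <= n ^ 2 ->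
  4 * k1 ^ 2 * missing_pairs e p <= n ^ 2 ->
  (#|opposite p x| <= 4 * missing_deg e p x) || (#|opposite p y| <= 4 * missing_deg e p y).
Proof.
move=> n0 part pxy sparse miss.
pose Q := (nbhd e x :&: nbhd e y) :&: opposite p x.
pose A := [set z | p x == p z].
have nA : n <= k1 * #|A|.
  have [z] : exists z, z \in opposite p x.
    by apply/card_gt0P; have := part x; case: #|_| => //; rewrite muln0 leqn0 (gtn_eqF n0).
  (* The part of [x] is opposite to any [z] across the cut, so the bound on opposite parts covers
     it. *)
  rewrite inE => xz; suff -> : A = opposite p z by [].
  by apply/setP => w; rewrite !inE; move: xz; case: (p x); case: (p z); case: (p w).
have AQ : #|A| * #|Q| <= \sum_(l in A) #|[set q in Q | e l q]| + missing_pairs e p.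
  by apply: missing_between => u v; rewrite !inE => /eqP <- /andP[].
have sub : \sum_(l in A) #|[set q in Q | e l q]| <=
           \sum_l #|[set q in nbhd e x :&: nbhd e y | e l q]|.
  apply: leq_trans (leq_sum_sub_card e (subsetT A) (subsetIl _ _)) _.
  by apply: eq_leq; apply: eq_bigl => l; rewrite inE.
have Qsmall : 2 * #|Q| <= #|opposite p x|.
  have k10 : 0 < k1 by move: nA n0; case: (k1) => //; rewrite mul0n; lia.
  rewrite -(leq_pmul2l k10); apply: leq_trans (part x); rewrite -(leq_pmul2l n0).
  move: AQ sub sparse miss; move: (\sum_(l in A) _) (\sum_l _) (missing_pairs e p).
  move=> s t m h1 h2 h3 h4.
  have h5 : 4 * k1 ^ 2 * (#|A| * #|Q|) <= 2 * n ^ 2.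
    by apply: (@leq_trans (4 * k1 ^ 2 * (t + m))); [rewrite leq_mul2l; apply/orP; right; lia | lia].
  have h6 : n * (k1 * (2 * #|Q|)) <= k1 * #|A| * (k1 * (2 * #|Q|)).
    by rewrite leq_mul2r nA orbT.
  have : 2 * (k1 * #|A| * (k1 * (2 * #|Q|))) = 4 * k1 ^ 2 * (#|A| * #|Q|) by ring.
  rewrite -mulnn in h5 *; lia.
have cover : #|opposite p x| <= #|Q| + (missing_deg e p x + missing_deg e p y).
  apply: (@leq_trans #|Q :|: ([set z in opposite p x | ~~ e x z] :|: [set z in opposite p y | ~~ e y z])|).
    apply/subset_leq_card/subsetP => z; rewrite !inE -pxy => xz; rewrite xz /= !andbT.
    by case: (e x z); case: (e y z).
  apply: leq_trans (leq_card_setU _ _) _; rewrite leq_add2l.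
  by apply: leq_trans (leq_card_setU _ _) _.
rewrite -(opposite_same pxy); move: Qsmall cover; lia.
Qed.

(** The set [S] of vertices missing at least a quarter of the opposite part covers all inner edges.
    Each of its vertices has inner degree at most [n / kd] but misses at least [n / (4 * k1)] cross
    pairs. *)
Lemma inner_le_missing k1 kd :
  (forall x, n <= k1 * #|opposite p x|) ->
  (forall x, kd * inner_deg e p x <= n) ->
  (forall x y, e x y -> p x = p y ->
    (#|opposite p x| <= 4 * missing_deg e p x) ||
    (#|opposite p y| <= 4 * missing_deg e p y)) ->
  kd * inner_pairs e p <= 8 * k1 * missing_pairs e p.
Proof.
move=> part small cover.
pose S := [set x | #|opposite p x| <= 4 * missing_deg e p x].
have inner_le : inner_pairs e p <= 2 * \sum_(x in S) inner_deg e p x.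
  pose i x y : nat := e x y && (p x == p y).
  have iE x : inner_deg e p x = \sum_y i x y.
    by rewrite /inner_deg card_sum_nat; apply: eq_bigr => y _; rewrite !inE.
  rewrite mul2n -addnn.
  have sE : \sum_(x in S) inner_deg e p x = \sum_x \sum_y (x \in S) * i x y.
    rewrite big_mkcond; apply: eq_bigr => x _; rewrite -big_distrr /= -iE.
    by case: (x \in S); rewrite ?mul1n ?mul0n.
  rewrite {1}sE sE [X in _ <= _ + X]exchange_big -big_split.
  apply: leq_sum => x _; rewrite -big_split; apply: leq_sum => y _ /=.
  have iC : i y x = i x y by rewrite /i eS eq_sym.
  rewrite iC /i; case: (boolP (e x y && _)) => // /andP[exy /eqP pxy].
  by have /orP[h|h] := cover x y exy pxy; rewrite !inE h // addnC.
have missing_ge : #|S| * n <= 4 * k1 * missing_pairs e p.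
  rewrite missing_pairsE -sum_nat_const big_distrr /= [leqLHS]big_mkcond.
  apply: leq_sum => x _; case: ifP => //; rewrite inE => xS.
  by apply: leq_trans (part x) _; rewrite [4 * k1]mulnC -mulnA leq_mul2l xS orbT.
have deg_le : kd * \sum_(x in S) inner_deg e p x <= #|S| * n.
  by rewrite big_distrr -sum_nat_const; apply: leq_sum => x _; apply: small.
apply: (@leq_trans (kd * (2 * \sum_(x in S) inner_deg e p x))).
  by rewrite leq_mul2l inner_le orbT.
lia.
Qed.

End Cleaning.

(** * The upper bound for graphs without F *)

Section Bound.
Variables (a b : nat) (V : finType) (F : sgraph V).
Hypothesis chiF : chromatic_number F = 3.
Hypothesis critF : exists e : {set V}, color_critical F e.

Lemma double_star_bound : exists n0, forall (T : finType) (G : sgraph T),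
  n0 <= #|T| -> is_free F G ->
  exists x y, [/\ 0 < x, 0 < y, x + y = #|T| &
    #|embeddings (@double_star_rel a b) (adj G)| <= x * y * weight a b x y].
Proof.
have [n1 [k0 [k0_gt0 balanced]]] := balanced_weight a b.
(* Parts will have at least [n / k1] vertices, and [C] bounds the ratio of missing to inner pairs;
   [kd], [k3], [k5] say how rare inner neighbours, inner pairs and triangles must be. The
   existentials keep the constants opaque. *)
have [k1 k1E] : exists k1, k1 = 4 * k0 by exists (4 * k0).
have k1_gt0 : 0 < k1 by rewrite k1E muln_gt0.
have [C [CE C_gt0]] : exists C, C = (2 * k1) ^ (a + b) * (a + b + 2) ^ 2 /\ 0 < C.
  by eexists; split; [reflexivity | rewrite muln_gt0 !expn_gt0 muln_gt0 k1_gt0 addn2].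
have [kd kdE] : exists kd, kd = 8 * k1 * C by exists (8 * k1 * C).
have kd_gt0 : 0 < kd by rewrite kdE !muln_gt0 k1_gt0.
have [k3 k3E] : exists k3, k3 = C * (2 * kd ^ 2 + 4 * k1 ^ 2) + 2 * k0 by eexists.
have k3_gt0 : 0 < k3 by rewrite k3E addn_gt0 orbC muln_gt0 k0_gt0.
have [k5 k5E] : exists k5,
  k5 = k3 * (2 * (2 * k0) ^ 3 + (2 * k0) ^ 2 * (a + b) * k0) by eexists.
have k5_gt0 : 0 < k5.
  by rewrite k5E muln_gt0 k3_gt0 addn_gt0 muln_gt0 expn_gt0 muln_gt0 k0_gt0.
have kd2_gt0 : 0 < 2 * kd ^ 2 by rewrite muln_gt0 expn_gt0 kd_gt0.
have k4_gt0 : 0 < 4 * k1 ^ 2 by rewrite muln_gt0 expn_gt0 k1_gt0.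
have [n2 sparse5] := free_sparse_nbhd chiF critF k5_gt0.
have [n3 sparsed] := free_sparse_nbhd chiF critF kd2_gt0.
have [n4 sparse4] := free_sparse_codegree chiF critF k4_gt0.
exists (n1 + n2 + n3 + n4 + 2 * k1 * (a + b + 1) + 1) => T G nn free.
set n := #|T| in nn *; set emb := #|_|.
have eS := @adj_sym T G; have eI := @adj_irrefl T G.
have [n_gt0 nn1 nn2 [nn3 nn4 nnk]] : [/\ 0 < n, n1 <= n, n2 <= n &
    [/\ n3 <= n, n4 <= n & 2 * k1 * (a + b + 1) <= n]].
  by move: nn; move: (2 * k1 * _) n; clear=> m n; do !split; lia.
case: (boolP [exists x : 'I_n.+1, exists y : 'I_n.+1,
   [&& 0 < x, 0 < y, x + y == n & emb <= x * y * weight a b x y]]).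
  by case/existsP => x /existsP[y /and4P[x0 y0 /eqP xy h]]; exists x, y.
(* From here on the graph strictly beats every complete bipartite graph with nonempty parts, and
   [emb] plays the role of [M]. *)
move=> /existsPn none; exfalso.
have M_lt x y : 0 < x -> 0 < y -> x + y = n -> x * y * weight a b x y < emb.
  move=> x0 y0 xy.
  have xn : x < n.+1 by rewrite ltnS -xy leq_addr.
  have yn : y < n.+1 by rewrite ltnS -xy leq_addl.
  have /existsPn/(_ (Ordinal yn)) /= := none (Ordinal xn).
  by rewrite x0 y0 xy eqxx /= -ltnNge.
have M_max x y x0 y0 xy := ltnW (M_lt x y x0 y0 xy).
have M_big : n ^ (a + b + 2) <= k0 * emb.
  have [x [y [x0 y0 xy h]]] := balanced n nn1.
  by apply: leq_trans h _; rewrite leq_mul2l M_max ?orbT.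
have tri : k5 * triangles (adj G) <= n ^ 3.
  by apply: triangles_le => x; apply: sparse5.
rewrite k5E in tri; have [p0 hp0] := stability eS eI k0_gt0 M_max M_big (card_embeddings_weight _ _ eS) n_gt0 tri.
have [p pmin] := exists_min_inner_pairs (adj G).
have inner_small : k3 * inner_pairs (adj G) p <= n ^ 2.
  by apply: leq_trans hp0; rewrite leq_mul2l pmin orbT.
have part_big x : n <= k1 * #|opposite p x|.
  rewrite k1E; apply: (@card_opposite_ge T (adj G)) => //.
    rewrite -(@leq_pmul2l (n ^ (a + b))) ?expn_gt0 ?n_gt0 // -expnD mulnCA.
    apply: leq_trans M_big _; rewrite leq_mul2l; apply/orP; right.
    exact: card_embeddings_crude.
  by apply: leq_trans inner_small; rewrite k3E leq_mul2r leq_addl orbT.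
have missing_lt : missing_pairs (adj G) p < C * inner_pairs (adj G) p.
  rewrite CE; apply: missing_lt_inner => //.
  (* The parts of the cut [p] are nonempty, so [M_lt] applies to its complete bipartite graph. *)
  rewrite card_embeddings_two_parts.
  have [x _] : exists x : T, x \in T by apply/card_gt0P.
  have o0 y : 0 < #|opposite p y|.
    by have := part_big y; case: #|_| => //; rewrite muln0 leqNgt n_gt0.
  have pos (c : bool) : 0 < #|[set x | p x == c]|.
    have := o0 x => /card_gt0P[z]; rewrite inE => xz; apply/card_gt0P.
    have [xc|xc] := eqVneq (p x) c; first by exists x; rewrite inE xc.
    by exists z; rewrite inE; move: xz xc; case: (p x); case: (p z); case: (c).
  have pT : #|[set x | p x]| = #|[set x | p x == true]| by apply: eq_card => y; rewrite !inE eqb_id.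
  have pF : #|[set x | ~~ p x]| = #|[set x | p x == false]| by apply: eq_card => y; rewrite !inE eqbF_neg.
  apply: M_lt; rewrite ?pT ?pF ?pos //.
  rewrite -pF -pT /n -(cardsC [set x | p x]); congr (_ + _).
  by apply: eq_card => y; rewrite !inE.
have missing_small k : C * k <= k3 -> k * missing_pairs (adj G) p <= n ^ 2.
  move=> Ck; apply: leq_trans inner_small.
  apply: (@leq_trans (k * (C * inner_pairs (adj G) p))).
    by rewrite leq_mul2l (ltnW missing_lt) orbT.
  by rewrite mulnA [k * C]mulnC leq_mul2r Ck orbT.
have miss_d : 2 * kd ^ 2 * missing_pairs (adj G) p <= n ^ 2.
  by apply: missing_small; rewrite k3E mulnDr -addnA leq_addr.
have miss_4 : 4 * k1 ^ 2 * missing_pairs (adj G) p <= n ^ 2.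
  by apply: missing_small; rewrite k3E mulnDr addnAC leq_addl.
have : kd * inner_pairs (adj G) p <= 8 * k1 * missing_pairs (adj G) p.
  apply: inner_le_missing => // [x|x y xy pxy].
    by apply: inner_deg_small => //; apply: sparsed.
  by apply: (@inner_edge_missing _ _ _ k1) => //; apply: sparse4.
(* As [kd = 8 * k1 * C], this contradicts [missing_lt]. *)
by apply/negP; rewrite -ltnNge kdE -[leqRHS]mulnA ltn_pmul2l // muln_gt0 k1_gt0.
Qed.

End Bound.

(** * The extremal number *)

Lemma eq_embeddings (U T : finType) (r : rel U) (e e' : rel T) :
  e =2 e' -> embeddings r e = embeddings r e'.
Proof.
move=> ee; apply/setP => f.
by apply/embeddingsP/embeddingsP => -[fi h]; split=> // x y /h; rewrite ee.
Qed.

Lemma embeddings_double_star a b (T : finType) (e : rel T) : symmetric e ->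
  embeddings (adj (double_star a b)) e = embeddings (@double_star_rel a b) e.
Proof. by apply: embeddings_rel_graph => -[[?|]|[?|]]. Qed.

Lemma adj_complete_bipartite n m :
  adj (complete_bipartite n m) =2 two_parts (fun x : 'I_n => x < m).
Proof.
move=> x y; rewrite adj_rel_graph /two_parts.
have [->|_] := eqVneq x y; first by rewrite eqxx.
by case: (ltnP x m); case: (ltnP y m).
Qed.

Lemma card_embeddings_complete_bipartite a b n m : m <= n ->
  #|embeddings (adj (double_star a b)) (adj (complete_bipartite n m))| =
  m * (n - m) * weight a b m (n - m).
Proof.
move=> mn; rewrite embeddings_double_star; last exact: adj_sym.
rewrite (eq_embeddings _ (@adj_complete_bipartite n m)) card_embeddings_two_parts.
have cm : #|[set x : 'I_n | x < m]| = m.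
  have wi : injective (widen_ord mn) by move=> i j /(congr1 val)/= /val_inj.
  rewrite -[RHS]card_ord -(card_imset _ wi).
  apply: eq_card => x; rewrite inE; apply/idP/imsetP => [xm|[y _ ->]]; last exact: (ltn_ord y).
  by exists (Ordinal xm) => //; apply: val_inj.
have cC : #|[set x : 'I_n | ~~ (x < m)]| = n - m.
  have := cardsC [set x : 'I_n | x < m]; rewrite cm card_ord => cE.
  have -> : n - m = #|~: [set x : 'I_n | x < m]| by lia.
  by apply: eq_card => x; rewrite !inE.
by rewrite cm cC.
Qed.

(** An embedding of [F] would pull the two parts back to a 2-colouring. *)
Lemma is_free_complete_bipartite (V : finType) (F : sgraph V) n m :
  chromatic_number F = 3 -> is_free F (complete_bipartite n m).
Proof.
move=> chi; apply/is_freeP/setP => f; rewrite in_set0; apply/negP => /embeddingsP[_ h].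
suff : colorable F 2.
  by move: chi; rewrite /chromatic_number; case: ex_minnP => k _ hk kE /hk; rewrite kE.
apply/existsP; exists [ffun x => inord (f x < m)].
apply/'forall_'forall_implyP => x y /h; rewrite adj_complete_bipartite /two_parts !ffunE.
by apply: contra => /eqP/(congr1 val); case: (f x < m); case: (f y < m); rewrite /= ?inordK.
Qed.

Lemma complete_bipartite_multipartite n m : 0 < m < n ->
  complete_multipartite 2 (complete_bipartite n m).
Proof.
case/andP=> m0 mn; exists (fun x : 'I_n => inord (m <= x)); split; last first.
  move=> x y; rewrite adj_complete_bipartite /two_parts -val_eqE /=.
  by rewrite !ltnNge; case: (m <= x); case: (m <= y); rewrite /= ?inordK.
move=> i; have n0 : 0 < n by apply: leq_trans mn.
have [i0|i1] := eqVneq (val i) 0.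
  by exists (Ordinal n0); apply: val_inj; rewrite /= leqn0 gtn_eqF // inordK.
exists (Ordinal mn); apply: val_inj; rewrite /= leqnn inordK //.
by case: i i1 => [[|[|k]] ik].
Qed.

Theorem theorem1p3 (a b : nat) (V : finType) (F : sgraph V)
    (chiF : chromatic_number F = 3)
    (critF : exists e : {set V}, color_critical F e) :
  weakly_turan_good (double_star a b) F /\
  (exists n0 : nat, forall n : nat, n0 <= n ->
     exists m : nat, m <= n /\
       turan_ex n (double_star a b) F
         = ncopies (double_star a b) (complete_bipartite n m)).
Proof.
(* The strict bounds on [m] supply the nonempty parts that [complete_multipartite] demands. *)
suff [n0 h] : exists n0, forall n, n0 <= n -> exists m, 0 < m < n /\
    turan_ex n (double_star a b) F
      = ncopies (double_star a b) (complete_bipartite n m).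
  split; exists n0 => n /h[m [mn eqm]].
    exists (complete_bipartite n m); rewrite chiF; split=> //.
    exact: complete_bipartite_multipartite.
  by exists m; split=> //; case/andP: mn => _ /ltnW.
have [n0 bound] := double_star_bound a b chiF critF.
exists (n0 + 2) => n nn.
have n1 : 1 < n.+1 by lia.
(* The value 1 shows that the range of the maximum is nonempty. *)
have one_ok : 0 < Ordinal n1 < n by rewrite /=; lia.
have [m mn m_max] := @arg_maxnP _ (Ordinal n1) (fun m : 'I_n.+1 => 0 < m < n)
  (fun m => m * (n - m) * weight a b m (n - m)) one_ok.
exists m; split=> //; apply/eqP; rewrite eqn_leq; apply/andP; split; last first.
  by apply: leq_bigmax_cond; apply: is_free_complete_bipartite.
apply/bigmax_leqP => G free; rewrite ncopies_le.
rewrite card_embeddings_complete_bipartite -1?ltnS // embeddings_double_star; last exact: adj_sym.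
have [|x [y [x0 y0]]] := bound _ G _ free; first by rewrite card_ord; lia.
rewrite card_ord => xy h; apply: leq_trans h _.
have xn : x < n.+1 by lia.
have -> : y = n - x by lia.
by apply: (m_max (Ordinal xn)); rewrite /=; lia.
Qed.
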